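(* For every $\delta>0$ there exist constants $C>0$ and $\epsilon_0>0$ such that for all $0<\epsilon<\epsilon_0$, with $h_0=\epsilon^{16+\delta}$, for all $0<h<h_0$ and all $u\in H^2(\mathbb{T}^2)$, $$\|u\|_{L^2(\mathbb{T}^2)}\leq C\epsilon^{-4}\|u\|_{L^2(\Omega_\epsilon)}+C\epsilon^{-2}h^{-2}\|(-h^2\Delta-1)u\|_{L^2(\mathbb{T}^2)}.$$
   Context: $\mathbb{T}^2=\mathbb{R}^2/\mathbb{Z}^2$ is the standard flat torus with Laplacian $\Delta=\partial_{x_1}^2+\partial_{x_2}^2$, and $\Omega_\epsilon=B(0,\epsilon)\subset\mathbb{T}^2$ is the ball of radius $\epsilon$ centered at $0$. The constant $C$ does not depend on $\epsilon$, $h$ or $u$. *)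

(* Defs.v *)
From HB Require Import structures.
From mathcomp Require Import all_boot all_order all_algebra.
From mathcomp Require Import complex.
From mathcomp Require Import all_classical all_reals all_analysis.
Set Implicit Arguments.
Unset Strict Implicit.
Unset Printing Implicit Defensive.
Import Order.TTheory GRing.Theory Num.Theory.
Import numFieldNormedType.Exports.
Local Open Scope classical_set_scope.
Local Open Scope ring_scope.

Section Torus.
Context {R : realType}.
Implicit Types (u f g : R * R -> R[i]) (phi v w : R * R -> R).

(* Functions on the torus R^2/Z^2 are functions on R^2 that are 1-periodic in
   each variable; subsets of the torus are Z^2-invariant subsets of R^2.
   Integration is over the fundamental domain [0, 1[^2. *)
Definition torus_periodic {T : Type} (F : R * R -> T) : Prop :=
  forall (x : R * R) (k l : int), F (x.1 + k%:~R, x.2 + l%:~R) = F x.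

Definition unit_cell : set (R * R) := `[0, 1[%classic `*` `[0, 1[%classic.

(* The library's Lebesgue measure lives on the alias measurableTypeR R of R, so
   Borel measurability on the plane is taken with respect to that alias too. *)
Local Notation plane := (measurableTypeR R * measurableTypeR R)%type.

Definition lebesgue2 : {measure set plane -> \bar R} :=
  (@lebesgue_measure R \x @lebesgue_measure R)%E.

(* Euclidean (not sup-norm) ball about the origin of the flat torus: the points
   at distance < r from the lattice Z^2. *)
Definition torus_ball (r : R) : set (R * R) :=
  [set x | exists k l : int,
     Num.sqrt ((x.1 - k%:~R) ^+ 2 + (x.2 - l%:~R) ^+ 2) < r].

Definition L2norm (A : set (R * R)) u : \bar R :=
  'N[lebesgue2]_2%:E
    [(fun x => (ComplexField.Normc.normc (u x))%:E) \_ (unit_cell `&` A)].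

Definition L2 u : Prop :=
  [/\ torus_periodic u,
      measurable_fun [set: plane] (fun x => complex.Re (u x)),
      measurable_fun [set: plane] (fun x => complex.Im (u x)) &
      (L2norm setT u < +oo)%E].

Definition e1 : R * R := (1, 0).
Definition e2 : R * R := (0, 1).

Definition partial (a : nat * nat) phi : R * R -> R :=
  iter a.1 (fun psi x => 'D_e1 psi x) (iter a.2 (fun psi x => 'D_e2 psi x) phi).

Fixpoint Ck (n : nat) phi : Prop :=
  continuous phi /\
  if n is n'.+1 then
    forall e : R * R, e = e1 \/ e = e2 ->
      (forall x, derivable phi x e) /\ Ck n' (fun x => 'D_e phi x)
  else True.

Definition test_function phi : Prop := torus_periodic phi /\ forall n, Ck n phi.

Definition weak_partialR (a : nat * nat) v w : Prop :=
  forall phi, test_function phi ->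
    \int[lebesgue2]_(x in unit_cell) (v x * partial a phi x) =
    (-1) ^+ (a.1 + a.2) * \int[lebesgue2]_(x in unit_cell) (w x * phi x).

(* Pairing the real and imaginary parts with all real test functions is the
   same, by linearity, as pairing with all complex ones. *)
Definition weak_partial (a : nat * nat) u g : Prop :=
  weak_partialR a (fun x => complex.Re (u x)) (fun x => complex.Re (g x)) /\
  weak_partialR a (fun x => complex.Im (u x)) (fun x => complex.Im (g x)).

Definition sobolevH (k : nat) u : Prop :=
  L2 u /\
  forall a : nat * nat, (a.1 + a.2 <= k)%N -> exists g, L2 g /\ weak_partial a u g.

(* Weak derivatives are only determined almost everywhere, so the Laplacian is
   a relation: f is a representative of the L2 class of the weak Laplacian. *)
Definition is_laplacian u f : Prop :=
  exists g1 g2, [/\ L2 g1, L2 g2, weak_partial (2, 0) u g1,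
    weak_partial (0, 2) u g2 & forall x, f x = g1 x + g2 x].

End Torus.

(* Main.v *)
(* The operator shifts the Fourier coefficient at k by 4 pi^2 |k|^2 - h^-2, and the
   values |k|^2 are integers. So if N is the integer closest to (2 pi h)^-2, the part
   r of u away from the circle |k|^2 = N has norm at most that of F = h^-2 (-h^2 Lap - 1) u,
   with no loss in eps, and it remains to bound the trigonometric polynomial u - r by
   its restriction to the square [0, eps/2)^2, which lies in the ball.
   Test |u - r|^2 against a tensor product bump weight. The frequencies are lattice points
   of a circle of radius sqrt N; since a lattice triangle inscribed in it has area at
   least 1/2, no three of them are within distance about N^(1/6) of each other. Hence the
   Gram matrix has at most one large off-diagonal entry in each row, smaller than the
   diagonal one by a factor 1 - c eps^2, and the other entries sum to O(N^(-1/6)), up to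
   powers of eps which h < eps^16 absorbs: it is diagonally dominant.
   Completeness of the trigonometric system is only needed as density: the sets
   whose indicator acts by multiplication on the closure of the trigonometric polynomials
   form a sigma-algebra, and it contains half planes because polynomials in
   cos (2 pi x) and sin (2 pi x) approximate their indicators boundedly. *)
Require Import Defs.
From HB Require Import structures.
From mathcomp Require Import all_boot all_order all_algebra.
From mathcomp Require Import complex.
From mathcomp Require Import zify ring lra.
From mathcomp Require Import all_classical all_reals all_analysis.
From mathcomp Require Import measurable_realfun.
Import Order.TTheory GRing.Theory Num.Theory.
Import numFieldNormedType.Exports.
Local Open Scope classical_set_scope.
Local Open Scope complex_scope.
Local Open Scope ring_scope.

Set Implicit Arguments.
Unset Strict Implicit.
Unset Printing Implicit Defensive.

(** * One-dimensional Fourier integrals *)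

Section Waves.
Context {R : realType}.
Implicit Types (f F : R -> R) (a b s t x eta al be : R).
Notation leb := (@lebesgue_measure R).

(** The obstacle is that two points of the circle can be lattice neighbours for arbitrarily large N,
    as (a, a + 1) and (a + 1, a) are, so an off-diagonal Gram entry need not be small: only its
    strict deficit can be used. On an interval of length eta a wave of bounded frequency deviates
    from a constant by order eta^2 if its phase is chosen well, so the deficit is no better than c =
    eta^7 / kappa against V = eta^5 / 30. One such neighbour is affordable, two would not be, and
    this is what the triangle bound excludes. The margin V c of the two-dimensional Gram matrix is
    of order eta^12; the bound eta^8 on the weight leaves eta^4, so squared norms lose eps^-4 and
    norms lose eps^-2. The far entries sum to less than half the margin once D is of order eps^-4;
    the triangle bound then asks for N beyond a constant times eps^-24, while h < eps^16 provides
    eps^-32 up to a constant. *)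

Lemma itvco_integrable f a b : continuous f ->
  leb.-integrable `[a, b[ (EFin \o f).
Proof.
move=> cf; apply: (@integrableS _ _ _ leb `[a, b]) => //=.
  by apply: subset_itvl; rewrite bnd_simp.
apply: continuous_compact_integrable; first exact: segment_compact.
exact: continuous_subspaceT.
Qed.

Lemma Rintegral_FTC f F a b : a < b -> continuous f ->
  (forall x, is_derive x 1 F (f x)) ->
  \int[leb]_(x in `[a, b[) f x = F b - F a.
Proof.
move=> ab cf dF.
have cF : continuous F.
  move=> x; apply/differentiable_continuous/derivable1_diffP.
  by have [] := dF x.
rewrite Rintegral_itv_bndo_bndc; last exact: itvco_integrable.
rewrite /Rintegral (@continuous_FTC2 _ f F)//.
- exact: continuous_subspaceT.
- split.
  + by move=> x _; have [] := dF x.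
  + exact: cvg_at_right_filter (cF a).
  + exact: cvg_at_left_filter (cF b).
- by move=> x _; rewrite derive1E; have [] := dF x.
Qed.

(** For a unit vector [(al, be)] this is a cosine of frequency [s] with arbitrary phase. Bounds
    uniform in the phase replace complex exponentials, and differentiation only rotates the pair
    [(al, be)]. *)
Definition wave (al be s t : R) := al * cos (s * t) + be * sin (s * t).

Lemma is_derive_wave al be s t :
  is_derive t 1 (wave al be s) (s * wave be (- al) s t).
Proof.
rewrite /wave; apply: trigger_derive.
rewrite /GRing.scale/=; ring.
Qed.

Lemma continuous_derive1 F f : (forall x, is_derive x 1 F (f x)) -> continuous F.
Proof.
move=> dF x; apply/differentiable_continuous/derivable1_diffP.
by have [] := dF x.
Qed.

Lemma continuous_wave al be s : continuous (wave al be s).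
Proof. exact: continuous_derive1 (is_derive_wave al be s). Qed.

Lemma wave_sqr al be s t : wave al be s t ^+ 2 + wave be (- al) s t ^+ 2 =
  al ^+ 2 + be ^+ 2.
Proof.
rewrite /wave -[RHS]mulr1 -(cos2Dsin2 (s * t)); ring.
Qed.

Lemma wave_le1 al be s t : al ^+ 2 + be ^+ 2 = 1 -> wave al be s t <= 1.
Proof. move: (wave_sqr al be s t) => + e; rewrite e => h; nra. Qed.

Lemma cos_sin_2pi_int (n : int) :
  cos (2 * pi * n%:~R) = 1 :> R /\ sin (2 * pi * n%:~R) = 0 :> R.
Proof.
have aux k : cos (2 * pi * k%:R) = 1 :> R /\ sin (2 * pi * k%:R) = 0 :> R.
  have e : 2 * pi * k%:R = 0 + pi *+ 2 *+ k :> R.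
    by rewrite add0r -[RHS]mulr_natr -[pi *+ 2]mulr_natl.
  rewrite e (periodicn (@cosD2pi R)) (periodicn (@sinD2pi R)).
  by rewrite cos0 sin0.
case: n => k; first exact: aux.
rewrite NegzE mulrNz mulrN cosN sinN; have [-> ->] := aux k.+1.
by rewrite oppr0.
Qed.

Lemma Rintegral_wave0 al be (m : int) : m != 0 ->
  \int[leb]_(t in `[0, 1[) wave al be (2 * pi * m%:~R) t = 0.
Proof.
move=> m0; set s := 2 * pi * m%:~R.
have s0 : s != 0.
  by rewrite !mulf_neq0// ?intr_eq0// gt_eqF// pi_gt0.
have dF t : is_derive t 1 (fun t => s^-1 * wave (- be) al s t) (wave al be s t).
  by rewrite /wave; apply: trigger_derive; rewrite /GRing.scale/=; field.
rewrite (Rintegral_FTC ltr01 (@continuous_wave al be s) dF).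
by rewrite /wave mulr1 mulr0 cos0 sin0 !(cos_sin_2pi_int m).1 !(cos_sin_2pi_int m).2; ring.
Qed.

Lemma Rintegral_ge0_subset (A B : set R) f : measurable A -> measurable B ->
  A `<=` B -> leb.-integrable B (EFin \o f) -> (forall x, B x -> 0 <= f x) ->
  \int[leb]_(x in A) f x <= \int[leb]_(x in B) f x.
Proof.
move=> mA mB AB fB f0; rewrite /Rintegral fine_le//.
- by apply: integrable_fin_num => //; apply: integrableS fB.
- exact: integrable_fin_num.
- apply: ge0_subset_integral => //; first by have /integrableP[] := fB.
Qed.

(** The lowest-degree polynomial weight with double zeros at both ends: they give the decay [s ^- 2]
    of the transform, which is summable over integer frequencies. *)
Definition bump (eta t : R) := t ^+ 2 * (eta - t) ^+ 2.

Lemma is_derive_bump eta t :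
  is_derive t 1 (bump eta) (2 * t * (eta - t) ^+ 2 - 2 * t ^+ 2 * (eta - t)).
Proof.
rewrite /bump; apply: trigger_derive.
rewrite /GRing.scale/=; ring.
Qed.

Lemma continuous_bump eta : continuous (bump eta).
Proof. exact: continuous_derive1 (is_derive_bump eta). Qed.

Lemma continuous_bump_wave eta al be s :
  continuous (fun t => bump eta t * wave al be s t).
Proof.
by move=> t; apply: continuousM; [exact: continuous_bump|exact: continuous_wave].
Qed.

Lemma bump_ge0 eta t : 0 <= bump eta t.
Proof. by rewrite mulr_ge0// sqr_ge0. Qed.

Lemma Rintegral_bump eta : 0 < eta ->
  \int[leb]_(t in `[0, eta[) bump eta t = eta ^+ 5 / 30.
Proof.
move=> eta0.
have dF t : is_derive t 1 (fun t => eta ^+ 2 / 3 * t ^+ 3 - eta / 2 * t ^+ 4 +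
    5^-1 * t ^+ 5) (bump eta t).
  by apply: trigger_derive; rewrite /GRing.scale/= /bump; field.
rewrite (Rintegral_FTC eta0 (@continuous_bump eta) dF). by field.
Qed.

(** After two integrations by parts the second derivative of the bump remains, divided by [s ^+ 2];
    it is at most [2 * eta ^+ 2] in absolute value on an interval of length [eta]. *)
Lemma bump_wave_far eta al be s : 0 < eta -> s != 0 -> al ^+ 2 + be ^+ 2 = 1 ->
  \int[leb]_(t in `[0, eta[) (bump eta t * wave al be s t) <= 2 * eta ^+ 3 / s ^+ 2.
Proof.
move=> eta0 s0 ab1.
pose b1 t := 2 * t * (eta - t) ^+ 2 - 2 * t ^+ 2 * (eta - t).
pose b2 t := 2 * (eta - t) ^+ 2 - 8 * t * (eta - t) + 2 * t ^+ 2.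
have db1 t : is_derive t 1 b1 (b2 t).
  rewrite /b1; apply: trigger_derive; rewrite /GRing.scale/= /b2; ring.
(* [G' = g] is two integrations by parts, the boundary terms vanishing because
   the bump has double zeros at both ends. *)
pose G t := - s^-1 * (bump eta t * wave be (- al) s t) +
  s^-2 * (b1 t * wave al be s t) + 2 * eta ^+ 2 / s ^+ 2 * t.
pose g t := bump eta t * wave al be s t +
  (2 * eta ^+ 2 + b2 t * wave al be s t) / s ^+ 2.
have dG t : is_derive t 1 G (g t).
  have hb := is_derive_bump eta t; have h1 := is_derive_wave al be s t.
  have h2 := is_derive_wave be (- al) s t; have h3 := db1 t.
  rewrite /G; apply: trigger_derive; rewrite /GRing.scale/= /g /b1 /wave; field.
  exact: s0.
have cg : continuous g.
  move=> t; apply: cvgD; first exact: continuous_bump_wave.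
  apply: cvgMl; apply: cvgD; first exact: cvg_cst.
  apply: cvgM; last exact: continuous_wave.
  suff: continuous b2 by apply.
  apply: (@continuous_derive1 _ (fun t => - 4 * (eta - t) - 8 * eta + 16 * t + 4 * t)).
  by move=> x; rewrite /b2; apply: trigger_derive; rewrite /GRing.scale/=; ring.
apply: (@le_trans _ _ (\int[leb]_(t in `[0, eta[) g t)); last first.
  rewrite (Rintegral_FTC eta0 cg dG) /G /b1 /bump.
  by rewrite le_eqVlt; apply/orP; left; apply/eqP; field.
apply: le_Rintegral => //; [|exact: itvco_integrable|].
  apply: itvco_integrable; exact: continuous_bump_wave.
move=> t /=; rewrite in_itv/= => /andP[t0 te].
rewrite /g lerDl divr_ge0 ?sqr_ge0//.
have := wave_sqr al be s t; rewrite ab1.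
have p0 : 0 <= t * (eta - t) by rewrite mulr_ge0// subr_ge0 ltW.
have p1 : 4 * (t * (eta - t)) <= eta ^+ 2.
  by have := sqr_ge0 (eta - 2 * t); rewrite -subr_ge0 => h; rewrite -subr_ge0; nra.
have -> : b2 t = 2 * eta ^+ 2 - 12 * (t * (eta - t)) by rewrite /b2; ring.
move: (t * (eta - t)) p0 p1 => p p0 p1.
move: (wave al be s t) (wave be (- al) s t) => x y xy.
have x1 : x <= 1 by nra.
have xN1 : -1 <= x by nra.
(* Both [1 + x] and [1 - x] are nonnegative, and so are their coefficients because
   [p <= eta ^+ 2 / 4]. *)
have -> : 2 * eta ^+ 2 + (2 * eta ^+ 2 - 12 * p) * x =
  (2 * eta ^+ 2 - 6 * p) * (1 + x) + 6 * p * (1 - x) by ring.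
by rewrite addr_ge0// mulr_ge0; lra.
Qed.

Lemma derive_ge0_ge0 F f : (forall x : R, is_derive x (1 : R) F (f x)) ->
  F 0 = 0 -> (forall x, 0 <= x -> 0 <= f x) -> forall x, 0 <= x -> 0 <= F x.
Proof.
move=> dF F0 f0 x x0; rewrite -F0; apply: (@ger0_derive1_le_cc _ F 0 x) => //.
- move=> z; rewrite in_itv/= => /andP[z0 _]; rewrite derive1E.
  by have [_ ->] := dF z; exact: f0 (ltW z0).
- exact/continuous_subspaceT/(continuous_derive1 dF).
- by rewrite in_itv/= lexx x0.
- by rewrite in_itv/= x0 lexx.
Qed.

(** Starting from [cos x <= 1], each inequality is the sign of the derivative of the next one, and
    all differences vanish at 0. *)
Lemma sin_taylor t : 0 <= t ->
  t - t ^+ 3 / 6 <= sin t /\ sin t <= t - t ^+ 3 / 6 + t ^+ 5 / 120.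
Proof.
have a : forall x : R, 0 <= x -> 0 <= x - sin x.
  have dF (x : R) : is_derive x 1 (fun x => x - sin x) (1 - cos x).
    by apply: trigger_derive; rewrite /GRing.scale/=; ring.
  apply: (derive_ge0_ge0 dF); first by rewrite sin0 subr0.
  by move=> x _; rewrite subr_ge0 cos_le1.
have b : forall x : R, 0 <= x -> 0 <= cos x - 1 + x ^+ 2 / 2.
  have dF (x : R) : is_derive x 1 (fun x => cos x - 1 + x ^+ 2 / 2) (x - sin x).
    by apply: trigger_derive; rewrite /GRing.scale/=; field.
  by apply: (derive_ge0_ge0 dF) => //; rewrite cos0; ring.
have c : forall x : R, 0 <= x -> 0 <= sin x - x + x ^+ 3 / 6.
  have dF (x : R) : is_derive x 1 (fun x => sin x - x + x ^+ 3 / 6) (cos x - 1 + x ^+ 2 / 2).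
    by apply: trigger_derive; rewrite /GRing.scale/=; field.
  by apply: (derive_ge0_ge0 dF) => //; rewrite sin0; ring.
have d : forall x : R, 0 <= x -> 0 <= 1 - x ^+ 2 / 2 + x ^+ 4 / 24 - cos x.
  have dF (x : R) :
      is_derive x 1 (fun x => 1 - x ^+ 2 / 2 + x ^+ 4 / 24 - cos x) (sin x - x + x ^+ 3 / 6).
    by apply: trigger_derive; rewrite /GRing.scale/=; field.
  by apply: (derive_ge0_ge0 dF) => //; rewrite cos0; ring.
have e : forall x : R, 0 <= x -> 0 <= x - x ^+ 3 / 6 + x ^+ 5 / 120 - sin x.
  have dF (x : R) : is_derive x 1
      (fun x => x - x ^+ 3 / 6 + x ^+ 5 / 120 - sin x) (1 - x ^+ 2 / 2 + x ^+ 4 / 24 - cos x).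
    by apply: trigger_derive; rewrite /GRing.scale/=; field.
  by apply: (derive_ge0_ge0 dF) => //; rewrite sin0; ring.
by move=> t0; have := c _ t0; have := e _ t0; split; lra.
Qed.

Lemma sin_defect t : 0 <= t ->
  t ^+ 3 / 10 <= t - `|sin t| \/ t / 2 <= t - `|sin t|.
Proof.
move=> t0; have [h1 h2] := sin_taylor t0.
(* Up to 2 the Taylor bound gives the factor [1/6 - 4/120], more than [1/10]; beyond 2,
   [t - 1 >= t / 2]. *)
have [t2|t2] := leP t 2; [left|right].
  have h : t ^+ 2 <= 4 by nra.
  have h3 : 0 <= t ^+ 3 by rewrite exprn_ge0.
  have e5 : t ^+ 5 = t ^+ 3 * t ^+ 2 by ring.
  have e3 : t ^+ 3 = t * t ^+ 2 by ring.
  rewrite ger0_norm; last by apply: le_trans h1; rewrite e3; nra.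
  by move: h2; rewrite e5; nra.
by have := sin_max t; lra.
Qed.

Lemma unit_dot_le al be x y t : al ^+ 2 + be ^+ 2 = 1 -> x ^+ 2 + y ^+ 2 <= t ^+ 2 ->
  0 <= t -> al * x + be * y <= t.
Proof.
move=> ab xyt t0; rewrite -(ger0_norm t0); apply: le_trans (ler_norm _) _.
rewrite -ler_sqr ?nnegrE// !real_normK ?num_real//.
apply: le_trans xyt; rewrite -[leRHS]mul1r -ab -subr_ge0.
by rewrite [leRHS](_ : _ = (al * y - be * x) ^+ 2) ?sqr_ge0//; ring.
Qed.

(** A wave is the scalar product of [(al, be)] with the point of the unit circle at angle [s * t];
    the right-hand side is the chord between the angles [s * x] and [s * y]. *)
Lemma wave_diff al be s x y : al ^+ 2 + be ^+ 2 = 1 ->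
  wave al be s x - wave al be s y <= 2 * `|sin (s * (x - y) / 2)|.
Proof.
move=> ab1.
have -> : wave al be s x - wave al be s y =
    al * (cos (s * x) - cos (s * y)) + be * (sin (s * x) - sin (s * y)).
  by rewrite /wave; ring.
apply: unit_dot_le => //; rewrite exprMn real_normK ?num_real//.
set w := s * (x - y) / 2.
have -> : s * x = s * y + w *+ 2 by rewrite /w -[_ *+ 2]mulr_natl; field.
rewrite (cosD (s * y)) (sinD (s * y)) cos_mulr2n sin_mulr2n.
have h1 := cos2Dsin2 w; have h2 := cos2Dsin2 (s * y).
move: (cos w) (sin w) (cos (s * y)) (sin (s * y)) h1 h2 => cw sw cy sy h1 h2.
have -> : (cy * (cw ^+ 2 *+ 2 - 1) - sy * ((cw * sw) *+ 2) - cy) ^+ 2 +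
  (sy * (cw ^+ 2 *+ 2 - 1) + cy * ((cw * sw) *+ 2) - sy) ^+ 2 =
  (cy ^+ 2 + sy ^+ 2) * ((cw ^+ 2 *+ 2 - 2) ^+ 2 + ((cw * sw) *+ 2) ^+ 2) by ring.
rewrite h2 mul1r.
have -> : cw ^+ 2 *+ 2 - 2 = - 2 * sw ^+ 2.
  have e : cw ^+ 2 = 1 - sw ^+ 2 by lra.
  by rewrite e; ring.
have -> : (- 2 * sw ^+ 2) ^+ 2 + (cw * sw *+ 2) ^+ 2 =
  (cw ^+ 2 + sw ^+ 2) * (2 ^+ 2 * sw ^+ 2) by ring.
by rewrite h1 mul1r.
Qed.

End Waves.

(** * The Fourier transform of the bump weight *)

Section BumpWeight.
Context {R : realType}.
Implicit Types (f F : R -> R) (a b s t x eta al be : R).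
Notation leb := (@lebesgue_measure R).

Lemma bump_le eta t : 0 <= t -> t <= eta -> bump eta t <= eta ^+ 4.
Proof.
move=> t0 te; rewrite /bump -exprMn (_ : eta ^+ 4 = (eta * eta) ^+ 2); last by ring.
have h : 0 <= eta - t <= eta by apply/andP; split; lra.
case/andP: h => h1 h2.
by rewrite ler_sqr ?nnegrE ?mulr_ge0 ?ler_pM// (le_trans t0).
Qed.

(* [eta ^+ 7 / kappa] is the gap between the integral of the bump and the modulus
   of its Fourier transform at a frequency at least 1. *)
Definition kappa : R := 32 * 320.

Lemma kappa_ge32 : 32 <= kappa.
Proof. by rewrite /kappa ler_peMr// ler1n. Qed.

(** The deficit is the integral of the nonnegative function [bump * (1 - wave)], so it may be
    bounded below on part of the interval, where a wave of nonzero frequency cannot stay equal to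
    1. *)
Lemma bump_wave_near eta al be s : 0 < eta -> eta <= 1 -> 1 <= `|s| ->
  al ^+ 2 + be ^+ 2 = 1 ->
  \int[leb]_(t in `[0, eta[) (bump eta t * wave al be s t) <=
    eta ^+ 5 / 30 - eta ^+ 7 / kappa.
Proof.
move=> eta0 eta1 s1 ab1.
wlog s0 : be s s1 ab1 / 0 <= s.
  move=> H; have [s0|s0] := leP 0 s; first exact: H.
  have := H (- be) (- s); rewrite normrN sqrrN oppr_ge0; move/(_ s1 ab1 (ltW s0)).
  apply: le_trans; rewrite le_eqVlt; apply/orP; left; apply/eqP.
  by apply: eq_Rintegral => t _; rewrite /wave mulNr cosN sinN; ring.
rewrite ger0_norm// in s1; have sgt0 : 0 < s := lt_le_trans ltr01 s1.
rewrite -Rintegral_bump// lerBrDr -lerBrDl -RintegralB//; last 2 first.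
- by apply: itvco_integrable; exact: continuous_bump.
- by apply: itvco_integrable; exact: continuous_bump_wave.
pose g t := bump eta t - bump eta t * wave al be s t.
have cg : continuous g.
  by move=> t; apply: cvgB; [exact: continuous_bump|exact: continuous_bump_wave].
have ge0 t : 0 <= g t.
  have -> : g t = bump eta t * (1 - wave al be s t) by rewrite /g; ring.
  by rewrite mulr_ge0 ?bump_ge0 ?subr_ge0 ?wave_le1.
pose J : set R := `[eta / 4, 3 * eta / 4[%classic.
have JD : J `<=` `[0, eta[.
  by move=> t; rewrite /J/= !in_itv/= => /andP[h1 h2]; apply/andP; split; lra.
apply: le_trans (_ : _ <= \int[leb]_(t in J) g t) _; last first.
  apply: Rintegral_ge0_subset => //; first by rewrite /J.
  exact: itvco_integrable.
(* On the middle half of the interval the bump is at least [eta ^+ 4 / 32], and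
   there [1 - wave] integrates to a multiple of [t - `|sin t|], [t = s * eta / 4]. *)
pose k t := eta ^+ 4 / 32 * (1 - wave al be s t).
have dK (t : R) : is_derive t 1
    (fun t => eta ^+ 4 / 32 * (t - s^-1 * wave (- be) al s t)) (k t).
  rewrite /wave /k; apply: trigger_derive; rewrite /GRing.scale/= /wave; field.
  by rewrite gt_eqF.
have ck : continuous k.
  move=> t; apply: cvgMr; apply: cvgB; first exact: cvg_cst.
  exact: continuous_wave.
have J0 : eta / 4 < 3 * eta / 4 by lra.
apply: le_trans (_ : _ <= \int[leb]_(t in J) k t) _; last first.
  apply: le_Rintegral; [by rewrite /J|exact: itvco_integrable..|].
  move=> t; rewrite /J/= in_itv/= => /andP[h1 h2].
  have -> : g t = bump eta t * (1 - wave al be s t) by rewrite /g; ring.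
  rewrite /k ler_wpM2r// ?subr_ge0 ?wave_le1//.
  (* On the middle half [t * (eta - t)] is smallest at the ends, with value [3/16 * eta ^+ 2]; the
     square of [3/16] is [9/256], which exceeds [1/32]. *)
  have : (3 / 16 * eta ^+ 2) ^+ 2 <= (t * (eta - t)) ^+ 2.
    have e2 : 0 <= eta ^+ 2 by rewrite sqr_ge0.
    have te : 0 <= t * (eta - t) by rewrite mulr_ge0; lra.
    rewrite ler_sqr ?nnegrE; [|lra|exact: te].
    have -> : t * (eta - t) = 3 / 16 * eta ^+ 2 + (t - eta / 4) * (3 * eta / 4 - t).
      by field.
    by rewrite lerDl mulr_ge0; lra.
  have e4 : 0 <= eta ^+ 4 by rewrite exprn_ge0// ltW.
  have -> : (3 / 16 * eta ^+ 2) ^+ 2 = 9 / 256 * eta ^+ 4 by field.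
  have -> : (t * (eta - t)) ^+ 2 = bump eta t by rewrite /bump; ring.
  lra.
rewrite (Rintegral_FTC J0 ck dK) -mulrBr.
have ab1' : (- be) ^+ 2 + al ^+ 2 = 1 by rewrite sqrrN addrC.
have := wave_diff s (3 * eta / 4) (eta / 4) ab1'.
have -> : s * (3 * eta / 4 - eta / 4) / 2 = s * eta / 4 by field.
set W1 := wave _ _ _ _; set W2 := wave _ _ _ _ => hW.
(* The factor 32 comes from the lower bound on the bump, and 320 from the cubic case of
   [sin_defect]: [2 * (1/4) ^+ 3 / 10 = 1/320]. *)
have -> : eta ^+ 7 / kappa = eta ^+ 4 / 32 * (eta ^+ 3 / 320) by rewrite /kappa; field.
rewrite ler_wpM2l//; first by rewrite divr_ge0// exprn_ge0// ltW.
have t0 : 0 <= s * eta / 4 by rewrite divr_ge0// mulr_ge0// ltW.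
have -> : 3 * eta / 4 - s^-1 * W1 - (eta / 4 - s^-1 * W2) =
    s^-1 * (s * eta / 2 - (W1 - W2)) by field; rewrite gt_eqF.
have e3 : eta ^+ 3 <= eta.
  by rewrite -[leRHS]expr1 ler_wiXn2l// ltW.
rewrite ler_pdivlMl//.
(* In the cubic case a spare factor [s ^+ 2] is discarded by [1 <= s]; the linear case follows from
   [eta ^+ 3 <= eta]. *)
have [h|h] := sin_defect t0.
  have : s * (eta ^+ 3 / 320) <= 2 * ((s * eta / 4) ^+ 3 / 10); last lra.
  have -> : 2 * ((s * eta / 4) ^+ 3 / 10) = s ^+ 2 * (s * (eta ^+ 3 / 320)) by field.
  have e3p : 0 <= eta ^+ 3 by rewrite exprn_ge0// ltW.
  have z0 : 0 <= s * (eta ^+ 3 / 320) by apply: mulr_ge0; lra.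
  by move: z0; move: (s * (eta ^+ 3 / 320)) => z z0; rewrite ler_peMl// exprn_ege1.
have : s * (eta ^+ 3 / 320) <= s * (eta / 4); last lra.
by rewrite ler_wpM2l//; lra.
Qed.

Lemma bump_gap_le eta : 0 < eta -> eta <= 1 -> 0 <= eta ^+ 7 / kappa <= eta ^+ 5 / 30.
Proof.
move=> eta0 eta1; have k32 := kappa_ge32; have k0 : 0 < kappa by lra.
have e0 n : 0 <= eta ^+ n by rewrite exprn_ge0// ltW.
rewrite divr_ge0 ?e0 ?(ltW k0)//=.
have -> : eta ^+ 7 / kappa = eta ^+ 5 * (eta ^+ 2 / kappa) by ring.
rewrite ler_wpM2l ?e0// ler_pdivrMr//.
have : eta ^+ 2 <= 1 by rewrite exprn_ile1// ltW.
lra.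
Qed.

Definition bumpC eta s := \int[leb]_(t in `[0, eta[) (bump eta t * cos (s * t)).
Definition bumpS eta s := \int[leb]_(t in `[0, eta[) (bump eta t * sin (s * t)).

Lemma Rintegral_bump_wave eta al be s : 
  \int[leb]_(t in `[0, eta[) (bump eta t * wave al be s t) =
  al * bumpC eta s + be * bumpS eta s.
Proof.
have ic : leb.-integrable `[0, eta[ (EFin \o (fun t => bump eta t * cos (s * t))).
  apply: itvco_integrable; have := @continuous_bump_wave _ eta 1 0 s.
  by rewrite /wave; under eq_fun do rewrite mul1r mul0r addr0.
have iS : leb.-integrable `[0, eta[ (EFin \o (fun t => bump eta t * sin (s * t))).
  apply: itvco_integrable; have := @continuous_bump_wave _ eta 0 1 s.
  by rewrite /wave; under eq_fun do rewrite mul1r mul0r add0r.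
rewrite -RintegralZl// -RintegralZl// -RintegralD//; last 2 first.
- exact: integrableZl ic.
- exact: integrableZl iS.
by apply: eq_Rintegral => t _; rewrite /wave; ring.
Qed.

(** Testing in the direction of [(x, y)] itself. This converts bounds valid for every phase of a
    wave into a bound on the modulus of the transform. *)
Lemma sqr_sum_le x y t : 0 <= t ->
  (forall al be, al ^+ 2 + be ^+ 2 = 1 -> al * x + be * y <= t) ->
  Num.sqrt (x ^+ 2 + y ^+ 2) <= t.
Proof.
move=> t0 H; set r := Num.sqrt _.
have r0 : 0 <= r by exact: sqrtr_ge0.
have rr : r ^+ 2 = x ^+ 2 + y ^+ 2 by rewrite sqr_sqrtr// addr_ge0// sqr_ge0.
have [->//|rn0] := eqVneq r 0.
have /H : (x / r) ^+ 2 + (y / r) ^+ 2 = 1.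
  by rewrite !expr_div_n -mulrDl -rr divff// expf_neq0.
apply: le_trans; rewrite le_eqVlt; apply/orP; left; apply/eqP.
by apply: (mulIf rn0); rewrite -expr2 rr; field.
Qed.

(** The modulus of the Fourier transform at [s] of the bump cut off to [[0, eta[]. *)
Definition bumpM eta s := Num.sqrt (bumpC eta s ^+ 2 + bumpS eta s ^+ 2).

Lemma bumpM_far eta s : 0 < eta -> s != 0 -> bumpM eta s <= 2 * eta ^+ 3 / s ^+ 2.
Proof.
move=> eta0 s0; apply: sqr_sum_le.
  by rewrite divr_ge0 ?sqr_ge0// mulr_ge0// exprn_ge0// ltW.
by move=> al be ab1; rewrite -Rintegral_bump_wave bump_wave_far.
Qed.

Lemma bumpM_near eta s : 0 < eta -> eta <= 1 -> 1 <= `|s| ->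
  bumpM eta s <= eta ^+ 5 / 30 - eta ^+ 7 / kappa.
Proof.
move=> eta0 eta1 s1; apply: sqr_sum_le.
  by have /andP[] := bump_gap_le eta0 eta1; rewrite subr_ge0.
by move=> al be ab1; rewrite -Rintegral_bump_wave bump_wave_near.
Qed.

Lemma bumpM_le eta s : 0 < eta -> bumpM eta s <= eta ^+ 5 / 30.
Proof.
move=> eta0; apply: sqr_sum_le; first by rewrite divr_ge0// exprn_ge0// ltW.
move=> al be ab1; rewrite -Rintegral_bump_wave -Rintegral_bump//.
apply: le_Rintegral => //.
- by apply: itvco_integrable; exact: continuous_bump_wave.
- by apply: itvco_integrable; exact: continuous_bump.
- by move=> t _; rewrite ler_piMr ?bump_ge0 ?wave_le1.
Qed.

End BumpWeight.

(** * Lattice points on circles *)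

Section Lattice.
Implicit Types (N K D : nat) (i j : int) (k l m p : int * int).

Definition int_range K : seq int := [seq Posz n - Posz K | n <- iota 0 K.*2.+1].

Lemma mem_int_range K i : (i \in int_range K) = (`|i| <= K%:Z).
Proof.
apply/mapP/idP => [[n]|iK]; first by rewrite mem_iota => h ->; lia.
by exists (absz (i + Posz K)); rewrite ?mem_iota; lia.
Qed.

Lemma int_range_uniq K : uniq (int_range K).
Proof. by rewrite map_inj_uniq ?iota_uniq// => a b; lia. Qed.

Definition circle N : seq (int * int) :=
  [seq p <- allpairs pair (int_range N) (int_range N) |
    p.1 ^+ 2 + p.2 ^+ 2 == N%:Z].

Lemma mem_circle N p : (p \in circle N) = (p.1 ^+ 2 + p.2 ^+ 2 == N%:Z).
Proof.
rewrite mem_filter andb_idr// => /eqP e; case: p e => a b; rewrite [X in X = _]/= => e.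
by apply: allpairs_f; rewrite mem_int_range; nia.
Qed.

Lemma circle_uniq N : uniq (circle N).
Proof.
apply: filter_uniq; apply: allpairs_uniq; try exact: int_range_uniq.
by move=> [a b] [c d].
Qed.

(* With difference vectors p and q this is the classical [abc = 4 R * area], squared;
   a nondegenerate lattice triangle has nonzero integer determinant. *)
Lemma circle_triangle N k l m : k \in circle N -> l \in circle N ->
    m \in circle N ->
  let p := (l.1 - k.1, l.2 - k.2) in let q := (m.1 - k.1, m.2 - k.2) in
  4 * N%:Z * (p.1 * q.2 - p.2 * q.1) ^+ 2 =
  (p.1 ^+ 2 + p.2 ^+ 2) * (q.1 ^+ 2 + q.2 ^+ 2) *
  ((l.1 - m.1) ^+ 2 + (l.2 - m.2) ^+ 2).
Proof.
rewrite !mem_circle; case: k l m => [a b] [c d] [e f] /= /eqP hk /eqP hl /eqP hm.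
have [x [y [z [t [ec [ed [ee ef]]]]]]] :
    exists x y z t, c = a + x /\ d = b + y /\ e = a + z /\ f = b + t.
  by exists (c - a), (d - b), (e - a), (f - b); rewrite !subrKC.
subst c d e f.
have hp : x ^+ 2 + y ^+ 2 = - 2 * (a * x + b * y).
  apply/eqP; rewrite -subr_eq0; apply/eqP.
  by transitivity (N%:Z - N%:Z); [rewrite -{1}hl -{1}hk; ring|ring].
have hq : z ^+ 2 + t ^+ 2 = - 2 * (a * z + b * t).
  apply/eqP; rewrite -subr_eq0; apply/eqP.
  by transitivity (N%:Z - N%:Z); [rewrite -{1}hm -{1}hk; ring|ring].
have e1 : a + x - a = x by ring.
have e2 : b + y - b = y by ring.
have e3 : a + z - a = z by ring.
have e4 : b + t - b = t by ring.
rewrite e1 e2 e3 e4 -hk.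
have -> : (a + x - (a + z)) ^+ 2 + (b + y - (b + t)) ^+ 2 =
  (x ^+ 2 + y ^+ 2) + (z ^+ 2 + t ^+ 2) - 2 * (x * z + y * t) by ring.
have -> : (x ^+ 2 + y ^+ 2) * (z ^+ 2 + t ^+ 2) *
   ((x ^+ 2 + y ^+ 2) + (z ^+ 2 + t ^+ 2) - 2 * (x * z + y * t)) =
   (x ^+ 2 + y ^+ 2) ^+ 2 * (z ^+ 2 + t ^+ 2) + (x ^+ 2 + y ^+ 2) * (z ^+ 2 + t ^+ 2) ^+ 2
   - 2 * (x * z + y * t) * (x ^+ 2 + y ^+ 2) * (z ^+ 2 + t ^+ 2) by ring.
set P := x ^+ 2 + y ^+ 2 in hp *; set Q := z ^+ 2 + t ^+ 2 in hq *.
(* With p = (x, y), q = (z, t) and k = (a, b), the product is the squared length of P q - Q p. Since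
   P = -2 k.p and Q = -2 k.q, that vector is k turned by a right angle and multiplied by twice the
   determinant, up to sign. *)
have -> : P ^+ 2 * Q + P * Q ^+ 2 - 2 * (x * z + y * t) * P * Q =
  (P * z - Q * x) ^+ 2 + (P * t - Q * y) ^+ 2 by rewrite /P /Q; ring.
by rewrite hp hq; ring.
Qed.

Definition close_points D k l := (`|l.1 - k.1| <= D%:Z) && (`|l.2 - k.2| <= D%:Z).

(** If [l] and [m] differed, the squared sides would be at most [2 D^2], [2 D^2] and [8 D^2], with
    product at most [32 D^6], whereas [circle_triangle] makes the product at least [4 N]. The same
    identity excludes a zero determinant, since it would force a side to vanish. *)
Lemma circle_near_unique N D k l m : (8 * D ^ 6 < N)%N ->
  k \in circle N -> l \in circle N -> m \in circle N ->
  l != k -> m != k -> close_points D k l -> close_points D k m -> l = m.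
Proof.
move=> DN kN lN mN lk mk kl km; have := circle_triangle kN lN mN => /=.
case/andP: kl => kl1 kl2; case/andP: km => km1 km2.
have sqD (x y z : int) : `|x| <= z -> `|y| <= z -> x ^+ 2 + y ^+ 2 <= 2 * z ^+ 2.
  by move=> xz yz; nia.
have h1 := sqD _ _ _ kl1 kl2; have h2 := sqD _ _ _ km1 km2.
have h3 : (l.1 - m.1) ^+ 2 + (l.2 - m.2) ^+ 2 <= 2 * (2 * D%:Z) ^+ 2.
  by apply: sqD; lia.
have pos (a b : int * int) : a != b -> 0 < (a.1 - b.1) ^+ 2 + (a.2 - b.2) ^+ 2.
  case: a b => [a1 a2] [b1 b2].
  rewrite xpair_eqE negb_and -(subr_eq0 a1) -(subr_eq0 a2) /= => ab.
  by rewrite lt_neqAle eq_sym paddr_eq0 ?sqr_ge0// !sqrf_eq0 negb_and ab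
    addr_ge0 ?sqr_ge0.
move=> e; apply/eqP; apply: contraT => lm; move: e.
have p1 := pos _ _ lk; have p2 := pos _ _ mk; have p3 := pos _ _ lm.
move: {sqD kl1 kl2 km1 km2 lN mN kN pos lk mk lm} (_ * _ - _ * _) h1 h2 h3 p1 p2 p3.
move=> det; move: (_ + _) (_ + _) (_ + _) => T Q P h1 h2 h3 p1 p2 p3 e.
have dn0 : det ^+ 2 != 0.
  apply/eqP => d0; move: e; rewrite d0 mulr0 => /esym/eqP.
  by rewrite !mulf_eq0 !gt_eqF.
have d1 : 1 <= det ^+ 2 by have := sqr_ge0 det; lia.
have : P * Q * T <= 2 * D%:Z ^+ 2 * (2 * D%:Z ^+ 2) * (2 * (2 * D%:Z) ^+ 2).
  apply: ler_pM h3; [by rewrite mulr_ge0// ltW|exact: ltW|].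
  by apply: ler_pM h1 h2; exact: ltW.
rewrite -e => h.
have : 4 * N%:Z <= 32 * (D ^ 6)%N%:Z.
  apply: le_trans (le_trans h _); first by rewrite ler_peMr.
  rewrite le_eqVlt; apply/orP; left; apply/eqP.
  by rewrite -[Posz (D ^ 6)]natz natrX natz; ring.
by move: DN; move: (D ^ 6)%N => z; lia.
Qed.

Lemma count_sqr_le2 (s : seq int) (c : int) : uniq s ->
  (count (fun j => j ^+ 2 == c) s <= 2)%N.
Proof.
move=> us; rewrite -size_filter.
have uf : uniq [seq j <- s | j ^+ 2 == c] by exact: filter_uniq.
case e : [seq j <- s | j ^+ 2 == c] uf => [//|j0 s'] uf.
have /(uniq_leq_size uf) : {subset j0 :: s' <= [:: j0; - j0]}; last by [].
move=> j; rewrite -e mem_filter => /andP[/eqP jc _].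
have : j0 \in [seq j <- s | j ^+ 2 == c] by rewrite e mem_head.
rewrite mem_filter => /andP[/eqP j0c _].
by rewrite !inE -eqf_sqr jc j0c.
Qed.

End Lattice.

(** * Row sums over the lattice points of a circle *)

Section LatticeSums.
Variable R : realFieldType.
Implicit Types (N K D : nat) (k l : int * int) (f : int -> R).

(** Over each abscissa there are at most two points, with opposite ordinates. *)
Lemma circle_sum_fst N (P : pred int) f : (forall i, P i -> 0 <= f i) ->
  \sum_(l <- circle N | P l.1) f l.1 <= 2 * \sum_(i <- int_range N | P i) f i.
Proof.
move=> f0; rewrite big_filter_cond big_mkcond big_allpairs mulr_sumr [leRHS]big_mkcond.
apply: ler_sum => i _.
case: ifPn => Pi; last by rewrite big1 //= => j _; rewrite andbF.
rewrite (eq_bigr (fun j => if j ^+ 2 == N%:Z - i ^+ 2 then f i else 0)); last first.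
  move=> j _; rewrite /= andbT; congr (if _ then _ else _).
  by rewrite -[RHS](inj_eq (addrI (i ^+ 2))) subrKC.
rewrite -big_mkcond/=.
rewrite -big_filter big_const_seq count_predT iter_addr_0 -[leLHS]mulr_natl.
by rewrite ler_wpM2r ?f0// ler_nat size_filter count_sqr_le2// int_range_uniq.
Qed.

Lemma circle_swap N f (P : pred int) :
  \sum_(l <- circle N | P l.2) f l.2 = \sum_(l <- circle N | P l.1) f l.1.
Proof.
pose sw (l : int * int) := (l.2, l.1).
have : perm_eq (circle N) (map sw (circle N)).
  apply: uniq_perm; first exact: circle_uniq.
    by rewrite map_inj_uniq ?circle_uniq// => -[a b] [c d] [-> ->].
  move=> [a b]; apply/idP/mapP => [|[[c d]]].
    by rewrite mem_circle => e; exists (b, a); rewrite ?mem_circle//= addrC.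
  by rewrite !mem_circle => e [-> ->]/=; rewrite addrC.
by move=> pe; rewrite (perm_big _ pe) big_map.
Qed.

Lemma int_range_inv_sqr_le K D (k : int) : (0 < D)%N ->
  \sum_(i <- int_range K | D%:Z < `|i - k|) (i - k)%:~R ^- 2 <= 2 / D%:R :> R.
Proof.
move=> D0.
have D0R : 0 < D%:R :> R by rewrite ltr0n.
(* [T] is monotone with [T (d + 1) - T d >= d ^- 2] for [`|d| > D], so the sum
   telescopes. *)
pose T (d : int) : R := if d <= - D%:Z then - d%:~R^-1 else
  if d <= D%:Z then D%:R^-1 else 2 / D%:R - (d - 1)%:~R^-1.
have T0 d : 0 <= T d <= 2 / D%:R.
  rewrite /T; case: ifPn => [h|_].
    have h' : d%:~R <= - D%:R :> R by rewrite -(ler_int R) rmorphN in h.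
    have d0 : 0 < - d%:~R :> R by rewrite oppr_gt0 (le_lt_trans h')// oppr_lt0.
    rewrite -invrN invr_ge0 ltW//= (@le_trans _ _ D%:R^-1)//.
      by rewrite lef_pV2 ?posrE// lerNr.
    by rewrite ler_peMl ?invr_ge0 ?ltW// ltr1n.
  case: ifPn => [_|h].
    by rewrite invr_ge0 ltW//= ler_peMl ?invr_ge0 ?ltW// ltr1n.
  have h' : D%:R <= (d - 1)%:~R :> R.
    by have : D%:Z <= d - 1 by [lia]; rewrite -(ler_int R).
  have d0 : 0 < (d - 1)%:~R :> R by rewrite (lt_le_trans D0R).
  have i0 : 0 <= ((d - 1)%:~R)^-1 :> R by rewrite invr_ge0 ltW.
  have i1 : ((d - 1)%:~R)^-1 <= D%:R^-1 :> R by rewrite lef_pV2.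
  by move: i0 i1; move: (_^-1) (D%:R^-1) => x y x0 xy; apply/andP; split; lra.
have Tinc d : (if D%:Z < `|d| then d%:~R ^- 2 else 0) <= T (d + 1) - T d.
  have tele (x : R) : 1 < x -> x ^- 2 <= (x - 1)^-1 - x^-1.
    move=> x1; have x0 : 0 < x by lra.
    have y0 : 0 < x - 1 by lra.
    have -> : (x - 1)^-1 - x^-1 = ((x - 1) * x)^-1.
      by field; rewrite !gt_eqF.
    rewrite lef_pV2 ?posrE ?exprn_gt0 ?mulr_gt0// expr2 ler_pM2r//; lra.
  case: ifPn => [|h].
    have [d0|d0] := leP 0 d => h.
      have h1 : (d + 1 <= - D%:Z) = false by lia.
      have h2 : (d + 1 <= D%:Z) = false by lia.
      have h3 : (d <= - D%:Z) = false by lia.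
      have h4 : (d <= D%:Z) = false by lia.
      rewrite /T h1 h2 h3 h4 addrK.
      have : (1 < d%:~R :> R) by rewrite (ltr_int R 1); lia.
      by move/tele => t; rewrite rmorphB/=; lra.
    have h1 : (d + 1 <= - D%:Z) = true by lia.
    have h3 : (d <= - D%:Z) = true by lia.
    rewrite /T h1 h3.
    have : (1 < (- d)%:~R :> R) by rewrite (ltr_int R 1); lia.
    move/tele; rewrite rmorphN/= sqrrN rmorphD/= => t.
    have e1 : - (d%:~R + 1)^-1 = (- d%:~R - 1)^-1 :> R by rewrite -invrN opprD.
    have e2 : - d%:~R^-1 = (- d%:~R)^-1 :> R by rewrite -invrN.
    by move: t; rewrite e1 e2.
  rewrite /T.
  have [->|dD] := eqVneq d D%:Z.
    have h1 : (D%:Z + 1 <= - D%:Z) = false by lia.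
    have h2 : (D%:Z + 1 <= D%:Z) = false by lia.
    have h3 : (D%:Z <= - D%:Z) = false by lia.
    by rewrite h1 h2 h3 lexx addrK; lra.
  have h1 : (d + 1 <= - D%:Z) = false by lia.
  have h2 : (d + 1 <= D%:Z) = true by lia.
  rewrite h1 h2; case: ifPn => [h3|h3].
    have -> : d = - D%:Z by lia.
    by rewrite rmorphN/= invrN opprK subrr.
  have -> : (d <= D%:Z) = true by lia.
  by rewrite subrr.
rewrite big_mkcond/= big_map/=.
pose U n := T (n%:Z - K%:Z - k).
apply: (@le_trans _ _ (\sum_(n <- iota 0 K.*2.+1) (U n.+1 - U n))).
  apply: ler_sum => n _; have := Tinc (n%:Z - K%:Z - k).
  by rewrite /U; congr (_ <= T _ - _); lia.
have := telescope_sumr U (leq0n K.*2.+1); rewrite /index_iota subn0 => ->.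
have /andP[_ h1] := T0 (K.*2.+1%:Z - K%:Z - k).
have /andP[h2 _] := T0 (0%:Z - K%:Z - k).
by rewrite /U; lra.
Qed.

Lemma sum_le_atmost1 (I : eqType) (s : seq I) (P : pred I) (F : I -> R) c :
  uniq s -> 0 <= c -> (forall x, P x -> F x <= c) ->
  (forall x y, x \in s -> y \in s -> P x -> P y -> x = y) ->
  \sum_(x <- s | P x) F x <= c.
Proof.
move=> us c0 Fc PU; rewrite -big_filter.
have : uniq [seq x <- s | P x] by exact: filter_uniq.
case e : [seq x <- s | P x] => [|x [|y s']]; first by rewrite big_nil.
  have : x \in [seq x <- s | P x] by rewrite e mem_head.
  by rewrite mem_filter big_seq1 => /andP[/Fc].
have : x \in [seq x <- s | P x] by rewrite e mem_head.
have : y \in [seq x <- s | P x] by rewrite e !inE eqxx orbT.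
rewrite !mem_filter => /andP[Py ys] /andP[Px xs].
by rewrite /= inE (PU x y)// eqxx.
Qed.

(* A point of the circle has at most one other point of the circle within
   distance D, which costs [V * (V - c)]; for the others the decay of [M] in one of
   the two coordinates is summed, each coordinate value being taken at most twice. *)
Lemma circle_gershgorin (M : int -> R) (V c B : R) N D k :
  (0 < D)%N -> (8 * D ^ 6 < N)%N -> k \in circle N -> 
  (forall i, 0 <= M i <= V) -> (forall i, i != 0 -> M i <= V - c) ->
  (forall i, i != 0 -> M i <= B / i%:~R ^+ 2) -> 0 <= B -> 0 <= c <= V ->
  \sum_(l <- circle N | l != k) M (l.1 - k.1) * M (l.2 - k.2) <=
    V * (V - c) + 8 * V * B / D%:R.
Proof.
move=> D0 DN kN M0 Mc MB B0 /andP[c0 cV].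
have V0 : 0 <= V := le_trans c0 cV.
rewrite (bigID (close_points D k))/= lerD//.
  apply: sum_le_atmost1; [exact: circle_uniq|by rewrite mulr_ge0 ?subr_ge0| |].
    move=> l /andP[lk _]; have : (l.1 - k.1 != 0) || (l.2 - k.2 != 0).
      by rewrite !subr_eq0 -negb_and -xpair_eqE -!surjective_pairing.
    have /andP[h1 h2] := M0 (l.1 - k.1); have /andP[h3 h4] := M0 (l.2 - k.2).
    case/orP => /Mc h; first by rewrite mulrC; apply: ler_pM.
    exact: ler_pM.
  move=> l m lN mN /andP[lk kl] /andP[mk km].
  exact: (@circle_near_unique N D k).
pose F (i j : int) : R := if D%:Z < `|i - j| then V * B * (i - j)%:~R ^- 2 else 0.
apply: (@le_trans _ _ (\sum_(l <- circle N) (F l.1 k.1 + F l.2 k.2))).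
  rewrite [leLHS]big_mkcond/= ler_sum// => l _.
  have F0 i j : 0 <= F i j.
    by rewrite /F; case: ifP => // _; rewrite !mulr_ge0// invr_ge0 sqr_ge0.
  case: ifPn => [/andP[_]|_]; last by rewrite addr_ge0.
  have /andP[h1 h2] := M0 (l.1 - k.1); have /andP[h3 h4] := M0 (l.2 - k.2).
  rewrite negb_and -!ltNge => /orP[h|h].
    apply: (@le_trans _ _ (F l.1 k.1)); last by rewrite lerDl.
    rewrite /F h mulrC -mulrA; apply: ler_pM => //; apply: MB; lia.
  apply: (@le_trans _ _ (F l.2 k.2)); last by rewrite lerDr.
  by rewrite /F h -mulrA; apply: ler_pM => //; apply: MB; lia.
(* The 4 is a factor 2 for the two points sharing a coordinate value times the 2 in [2 / D], which
   counts the two tails of the sum of inverse squares. *)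
have FE (s : int) : \sum_(l <- circle N) F l.1 s <= 4 * V * B / D%:R.
  rewrite -big_mkcond/=.
  apply: le_trans (@circle_sum_fst N (fun i => D%:Z < `|i - s|)
    (fun i => V * B * (i - s)%:~R ^- 2) _) _.
    by move=> i _; rewrite !mulr_ge0// invr_ge0 sqr_ge0.
  rewrite -mulr_sumr mulrA.
  apply: le_trans (ler_wpM2l _ (int_range_inv_sqr_le _ _ D0)) _.
    by rewrite !mulr_ge0.
  by rewrite le_eqVlt; apply/orP; left; apply/eqP; ring.
have FE2 (s : int) : \sum_(l <- circle N) F l.2 s <= 4 * V * B / D%:R.
  apply: le_trans (FE s); rewrite -[leLHS]big_mkcond -[leRHS]big_mkcond/=.
  by rewrite (circle_swap N (fun i => V * B * (i - s)%:~R ^- 2) (fun i => D%:Z < `|i - s|)).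
rewrite big_split/=; have := FE k.1; have := FE2 k.2.
have -> : 8 * V * B / D%:R = 4 * V * B / D%:R + 4 * V * B / D%:R by ring.
lra.
Qed.

End LatticeSums.

(** * Trigonometric polynomials on small squares *)

Section ProductIntegral.
Context d1 d2 (T1 : measurableType d1) (T2 : measurableType d2) (R : realType).
Variables (m1 : {sigma_finite_measure set T1 -> \bar R})
          (m2 : {sigma_finite_measure set T2 -> \bar R}).
Implicit Types (A : set T1) (B : set T2) (f : T1 -> R) (g : T2 -> R).

Let integrable_tensorT f g :
  m1.-integrable setT (EFin \o f) -> m2.-integrable setT (EFin \o g) ->
  (m1 \x m2)%E.-integrable setT (EFin \o (fun z => f z.1 * g z.2)).
Proof.
move=> fi gi.
have /measurable_EFinP mf := measurable_int _ fi.
have /measurable_EFinP mg := measurable_int _ gi.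
apply/integrable12ltyP.
  apply/measurable_EFinP; apply: measurable_funM.
    exact: measurableT_comp mf measurable_fst.
  exact: measurableT_comp mg measurable_snd.
have /integrableP[_ fy] := fi; have /integrableP[_ gy] := gi.
have mf' : measurable_fun setT (fun x => `|(f x)%:E|%E).
  by apply: measurableT_comp => //; exact/measurable_EFinP.
have mg' : measurable_fun setT (fun x => `|(g x)%:E|%E).
  by apply: measurableT_comp => //; exact/measurable_EFinP.
have fE : (\int[m1]_x `|(f x)%:E|)%E \is a fin_num.
  by rewrite ge0_fin_numE// integral_ge0.
have gE : (\int[m2]_y `|(g y)%:E|)%E \is a fin_num.
  by rewrite ge0_fin_numE// integral_ge0.
rewrite (_ : (fun x => _) = fun x => (`|(f x)%:E| * \int[m2]_y `|(g y)%:E|)%E); last first.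
  apply/funext => x.
  rewrite -ge0_integralZl//.
  by apply: eq_integral => y _; rewrite /= normrM EFinM.
rewrite -(fineK gE) ge0_integralZr//.
- by rewrite -(fineK fE) -EFinM ltry.
- by rewrite lee_fin fine_ge0// integral_ge0.
Qed.

Let Rintegral_tensorT f g :
  m1.-integrable setT (EFin \o f) -> m2.-integrable setT (EFin \o g) ->
  \int[(m1 \x m2)%E]_z (f z.1 * g z.2) = \int[m1]_x f x * \int[m2]_y g y.
Proof.
move=> fi gi; rewrite {1}/Rintegral.
have h := integrable_tensorT fi gi.
rewrite -[X in fine X](integral12_prod_meas1 h)/=.
have gE : (\int[m2]_y (g y)%:E)%E \is a fin_num by exact: integrable_fin_num gi.
rewrite (_ : (fun x => _) = fun x => ((f x)%:E * \int[m2]_y (g y)%:E)%E); last first.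
  by apply/funext => x; rewrite -integralZl.
rewrite -(fineK gE) integralZr//= fineM//.
exact: integrable_fin_num fi.
Qed.

Let tensor_restrict A B f g :
  (fun z : T1 * T2 => (f \_ A) z.1 * (g \_ B) z.2) =
  (fun z => f z.1 * g z.2) \_ (A `*` B).
Proof.
apply/funext => -[x y]; rewrite /= !patchE in_setX/=.
by case: (x \in A); case: (y \in B); rewrite ?mulr0 ?mul0r.
Qed.

Lemma integrable_tensor A B f g : measurable A -> measurable B ->
  m1.-integrable A (EFin \o f) -> m2.-integrable B (EFin \o g) ->
  (m1 \x m2)%E.-integrable (A `*` B) (EFin \o (fun z => f z.1 * g z.2)).
Proof.
move=> mA mB fi gi; apply/integrable_mkcond; first exact: measurableX.
rewrite restrict_EFin -tensor_restrict; apply: integrable_tensorT.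
  by move/(integrable_mkcond _ mA): fi; rewrite restrict_EFin.
by move/(integrable_mkcond _ mB): gi; rewrite restrict_EFin.
Qed.

Lemma Rintegral_tensor A B f g : measurable A -> measurable B ->
  m1.-integrable A (EFin \o f) -> m2.-integrable B (EFin \o g) ->
  \int[(m1 \x m2)%E]_(z in A `*` B) (f z.1 * g z.2) =
  \int[m1]_(x in A) f x * \int[m2]_(y in B) g y.
Proof.
move=> mA mB fi gi.
rewrite Rintegral_mkcond [X in X * _]Rintegral_mkcond [X in _ * X]Rintegral_mkcond.
rewrite -tensor_restrict Rintegral_tensorT//.
  by move/(integrable_mkcond _ mA): fi; rewrite restrict_EFin.
by move/(integrable_mkcond _ mB): gi; rewrite restrict_EFin.
Qed.

End ProductIntegral.

Section RintegralSum.
Context d (T : measurableType d) (R : realType) (mu : {measure set T -> \bar R}).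

Lemma integrable_lin (D : set T) (f g : T -> R) (a b : R) : measurable D ->
  mu.-integrable D (EFin \o f) -> mu.-integrable D (EFin \o g) ->
  mu.-integrable D (EFin \o (fun x => a * f x + b * g x)).
Proof.
move=> mD fi gi.
rewrite (_ : EFin \o _ = (fun x => a%:E * (EFin \o f) x) \+ (fun x => b%:E * (EFin \o g) x))%E.
  by apply: integrableD => //; exact: integrableZl.
by apply/funext => x.
Qed.

Lemma Rintegral_lin (D : set T) (f g : T -> R) (a b : R) : measurable D ->
  mu.-integrable D (EFin \o f) -> mu.-integrable D (EFin \o g) ->
  \int[mu]_(x in D) (a * f x + b * g x) =
  a * \int[mu]_(x in D) f x + b * \int[mu]_(x in D) g x.
Proof.
move=> mD fi gi; rewrite -RintegralZl// -RintegralZl// -RintegralD//.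
- exact: integrableZl fi.
- exact: integrableZl gi.
Qed.

Lemma integrable_sumR (D : set T) I (s : seq I) (P : pred I) (f : I -> T -> R) :
  measurable D -> (forall i, P i -> mu.-integrable D (EFin \o f i)) ->
  mu.-integrable D (EFin \o (fun x => \sum_(i <- s | P i) f i x)).
Proof.
move=> mD fi.
rewrite (_ : EFin \o _ = (fun x => (\sum_(i <- s | P i) (EFin \o f i) x)%E)).
  exact: integrable_sum.
by apply/funext => x; rewrite /= sumEFin.
Qed.

Lemma Rintegral_sum (D : set T) I (s : seq I) (f : I -> T -> R) :
  measurable D -> (forall i, mu.-integrable D (EFin \o f i)) ->
  \int[mu]_(x in D) (\sum_(i <- s) f i x) = \sum_(i <- s) \int[mu]_(x in D) f i x.
Proof.
move=> mD fi; elim: s => [|i s IH].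
  under eq_Rintegral do rewrite big_nil.
  by rewrite big_nil Rintegral_cst// mul0r.
under eq_Rintegral do rewrite big_cons.
by rewrite RintegralD ?big_cons ?IH//; exact: integrable_sumR.
Qed.

End RintegralSum.

(** * Diagonal dominance of a quadratic form *)

Section SchurTest.
Variables (R : realFieldType) (I : eqType).

(** The bound on an off-diagonal entry is shared equally by its two indices; symmetry of [W] turns
    the column half into a row sum, so each index [k] pays at most [G * a k]. *)
Lemma schur_lower (s : seq I) (a : I -> R) (Q W : I -> I -> R) (V G : R) :
  uniq s -> (forall k, 0 <= a k) -> (forall k, Q k k = V * a k) ->
  (forall k l, k != l -> - ((a k + a l) / 2 * W k l) <= Q k l) ->
  (forall k l, W k l = W l k) ->
  (forall k, k \in s -> \sum_(l <- s | l != k) W k l <= G) ->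
  (V - G) * \sum_(k <- s) a k <= \sum_(k <- s) \sum_(l <- s) Q k l.
Proof.
move=> us a0 QV QW Wsym WG.
pose S := \sum_(k <- s) \sum_(l <- s | l != k) a k * W k l.
have SG : S <= G * \sum_(k <- s) a k.
  rewrite mulr_sumr /S big_seq [leRHS]big_seq; apply: ler_sum => k ks.
  by rewrite -mulr_sumr mulrC ler_wpM2r// WG.
have S' : \sum_(k <- s) \sum_(l <- s | l != k) a l * W k l = S.
  rewrite /S; under eq_bigr do rewrite big_mkcond.
  rewrite exchange_big/=; apply: eq_bigr => k _.
  rewrite [RHS]big_mkcond/=; apply: eq_bigr => l _.
  by rewrite eq_sym Wsym.
apply: (@le_trans _ _ (\sum_(k <- s) (V * a k - \sum_(l <- s | l != k) (a k + a l) / 2 * W k l))).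
  rewrite sumrB -mulr_sumr.
  have -> : \sum_(k <- s) \sum_(l <- s | l != k) (a k + a l) / 2 * W k l = S.
    transitivity (2^-1 * (S + S)); last by field.
    rewrite -{2}S' /S -big_split/= mulr_sumr; apply: eq_bigr => k _.
    rewrite -big_split/= mulr_sumr; apply: eq_bigr => l _; by field.
  by rewrite mulrBl lerD2l lerN2.
rewrite big_seq [leRHS]big_seq; apply: ler_sum => k ks.
rewrite [leRHS](bigD1_seq k)//= QV lerD2l -sumrN ler_sum// => l lk.
by rewrite QW// eq_sym.
Qed.

End SchurTest.

(** * The Gram matrix of the frequencies on a circle *)

Section TrigonometricPolynomials.
Context {R : realType}.
Implicit Types (k l m : int * int) (x : R * R) (e eta : R) (v f g : R -> R).
Notation leb := (@lebesgue_measure R).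
Notation leb2 := (@lebesgue2 R).

Definition freq (i : int) : R := 2 * pi * i%:~R.
Definition theta k x : R := freq k.1 * x.1 + freq k.2 * x.2.
Definition square e : set (R * R) := `[0, e[%classic `*` `[0, e[%classic.

Lemma measurable_square e : measurable (square e : set (measurableTypeR R * measurableTypeR R)).
Proof. exact: measurableX. Qed.

Lemma integrable_square_tensor e f g : continuous f -> continuous g ->
  leb2.-integrable (square e) (EFin \o (fun x => f x.1 * g x.2)).
Proof. by move=> cf cg; apply: integrable_tensor => //; exact: itvco_integrable. Qed.

Lemma Rintegral_square_tensor e f g : continuous f -> continuous g ->
  \int[leb2]_(x in square e) (f x.1 * g x.2) =
  \int[leb]_(t in `[0, e[) f t * \int[leb]_(t in `[0, e[) g t.
Proof. by move=> cf cg; apply: Rintegral_tensor => //; exact: itvco_integrable. Qed.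

Definition waveI e v al be s := \int[leb]_(t in `[0, e[) (v t * wave al be s t).

Lemma square_tensor_lin e a b f1 g1 f2 g2 (F : R * R -> R) :
  continuous f1 -> continuous g1 -> continuous f2 -> continuous g2 ->
  (forall x, F x = a * (f1 x.1 * g1 x.2) + b * (f2 x.1 * g2 x.2)) ->
  leb2.-integrable (square e) (EFin \o F) /\
  \int[leb2]_(x in square e) F x =
  a * (\int[leb]_(t in `[0, e[) f1 t * \int[leb]_(t in `[0, e[) g1 t) +
  b * (\int[leb]_(t in `[0, e[) f2 t * \int[leb]_(t in `[0, e[) g2 t).
Proof.
move=> cf1 cg1 cf2 cg2 /funext ->.
have i1 := integrable_square_tensor e cf1 cg1.
have i2 := integrable_square_tensor e cf2 cg2.
have ms := measurable_square e.
split; first exact: integrable_lin ms i1 i2.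
by rewrite (Rintegral_lin _ _ ms i1 i2) !Rintegral_square_tensor.
Qed.

Lemma continuous_weight_wave v al be s : continuous v ->
  continuous (fun t : R => v t * wave al be s t).
Proof. by move=> cv t; apply: continuousM; [exact: cv|exact: continuous_wave]. Qed.

(** Stated for any continuous [v] because two weights are needed: the constant 1 for orthogonality
    on the cell, the bump for the Gram matrix. *)
Lemma weight_cos e v m : continuous v ->
  leb2.-integrable (square e) (EFin \o (fun x => v x.1 * v x.2 * cos (theta m x))) /\
  \int[leb2]_(x in square e) (v x.1 * v x.2 * cos (theta m x)) =
  waveI e v 1 0 (freq m.1) * waveI e v 1 0 (freq m.2) -
  waveI e v 0 1 (freq m.1) * waveI e v 0 1 (freq m.2).
Proof.
move=> cv; rewrite -[X in X - _]mul1r -mulN1r.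
apply: square_tensor_lin; try exact: continuous_weight_wave.
by move=> x; rewrite /theta cosD /wave; ring.
Qed.

Lemma weight_sin e v m : continuous v ->
  leb2.-integrable (square e) (EFin \o (fun x => v x.1 * v x.2 * sin (theta m x))) /\
  \int[leb2]_(x in square e) (v x.1 * v x.2 * sin (theta m x)) =
  waveI e v 0 1 (freq m.1) * waveI e v 1 0 (freq m.2) +
  waveI e v 1 0 (freq m.1) * waveI e v 0 1 (freq m.2).
Proof.
move=> cv; rewrite -[X in X + _]mul1r -[X in _ + X]mul1r.
apply: square_tensor_lin; try exact: continuous_weight_wave.
by move=> x; rewrite /theta sinD /wave; ring.
Qed.

Lemma thetaB k l x : theta k x - theta l x = theta (k.1 - l.1, k.2 - l.2) x.
Proof. by rewrite /theta /freq/= !rmorphB/=; ring. Qed.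

(** [trigR] and [trigI] are the real and imaginary parts of the trigonometric polynomial with
    complex coefficients p k + i q k. *)
Definition trigR (s : seq (int * int)) (p q : int * int -> R) x : R :=
  \sum_(k <- s) (p k * cos (theta k x) - q k * sin (theta k x)).
Definition trigI (s : seq (int * int)) (p q : int * int -> R) x : R :=
  \sum_(k <- s) (p k * sin (theta k x) + q k * cos (theta k x)).

Lemma trig_sqr s p q x : trigR s p q x ^+ 2 + trigI s p q x ^+ 2 =
  \sum_(k <- s) \sum_(l <- s)
    ((p k * p l + q k * q l) * cos (theta (k.1 - l.1, k.2 - l.2) x) +
     (p k * q l - q k * p l) * sin (theta (k.1 - l.1, k.2 - l.2) x)).
Proof.
rewrite /trigR /trigI !expr2 !big_distrlr -big_split/=; apply: eq_bigr => k _.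
rewrite -big_split/=; apply: eq_bigr => l _.
by rewrite -thetaB cosB sinB; ring.
Qed.

Lemma Rintegral_cell_trig m :
  \int[leb2]_(x in square 1) cos (theta m x) = (m == (0, 0))%:R /\
  \int[leb2]_(x in square 1) sin (theta m x) = 0.
Proof.
have c1 : continuous (fun _ : R => 1 : R) by move=> t; exact: cvg_cst.
have [_ hc] := weight_cos 1 m c1; have [_ hs] := weight_sin 1 m c1.
have W0 al be (i : int) : waveI 1 (fun _ => 1) al be (freq i) = if i == 0 then al else 0.
  rewrite /waveI; under eq_Rintegral do rewrite mul1r.
  case: eqP => [->|/eqP i0]; last exact: Rintegral_wave0.
  under eq_Rintegral do rewrite /wave /freq mulr0 mul0r cos0 sin0 mulr1 mulr0 addr0.
  by rewrite Rintegral_cst//= lebesgue_measure_itv/= lte01/= subr0 mulr1.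
case: m hc hs => m1 m2 /= hc hs; split.
  under eq_Rintegral do rewrite -[cos _]mul1r -{1}[1]mulr1.
  by rewrite hc !W0 xpair_eqE; case: eqP; case: eqP; rewrite /= ?mulr0 ?mul0r ?mulr1 ?subr0.
under eq_Rintegral do rewrite -[sin _]mul1r -{1}[1]mulr1.
by rewrite hs !W0; do 2 case: eqP; rewrite /= ?mulr0 ?mul0r ?addr0.
Qed.

Lemma bumpM_even eta (i : int) : bumpM eta (freq (- i)) = bumpM eta (freq i).
Proof.
rewrite /bumpM /bumpC /bumpS /freq rmorphN/= mulrN; congr (Num.sqrt (_ + _)).
  by under eq_Rintegral do rewrite mulNr cosN.
have iS : leb.-integrable `[0, eta[ (EFin \o (fun t => bump eta t * sin (2 * pi * i%:~R * t))).
  apply: itvco_integrable => t; apply: continuousM; first exact: continuous_bump.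
  apply: continuous_comp; last exact: continuous_sin.
  exact: mulrl_continuous.
rewrite -[RHS]sqrrN -[in RHS]mulN1r -[in RHS]RintegralZl//.
by congr (_ ^+ 2); apply: eq_Rintegral => t _; rewrite mulNr sinN; ring.
Qed.

Lemma integrable_trig_sqr_weight e v s p q : continuous v ->
  leb2.-integrable (square e)
    (EFin \o (fun x => v x.1 * v x.2 * (trigR s p q x ^+ 2 + trigI s p q x ^+ 2))) /\
  \int[leb2]_(x in square e)
    (v x.1 * v x.2 * (trigR s p q x ^+ 2 + trigI s p q x ^+ 2)) =
  \sum_(k <- s) \sum_(l <- s)
    ((p k * p l + q k * q l) *
       \int[leb2]_(x in square e) (v x.1 * v x.2 * cos (theta (k.1 - l.1, k.2 - l.2) x)) +
     (p k * q l - q k * p l) *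
       \int[leb2]_(x in square e) (v x.1 * v x.2 * sin (theta (k.1 - l.1, k.2 - l.2) x))).
Proof.
move=> cv; pose W x := v x.1 * v x.2.
rewrite (_ : (fun x => _) = fun x => \sum_(k <- s) \sum_(l <- s)
   ((p k * p l + q k * q l) * (W x * cos (theta (k.1 - l.1, k.2 - l.2) x)) +
    (p k * q l - q k * p l) * (W x * sin (theta (k.1 - l.1, k.2 - l.2) x)))); last first.
  apply/funext => x; rewrite trig_sqr mulr_sumr; apply: eq_bigr => k _.
  by rewrite mulr_sumr; apply: eq_bigr => l _; rewrite /W; ring.
have ms := measurable_square e.
have ii k l : leb2.-integrable (square e) (EFin \o (fun x =>
   ((p k * p l + q k * q l) * (W x * cos (theta (k.1 - l.1, k.2 - l.2) x)) +
    (p k * q l - q k * p l) * (W x * sin (theta (k.1 - l.1, k.2 - l.2) x))))).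
  apply: integrable_lin => //.
  - exact: (weight_cos _ _ cv).1.
  - exact: (weight_sin _ _ cv).1.
split; first by apply: integrable_sumR => // k _; apply: integrable_sumR.
rewrite Rintegral_sum//; last by move=> k; apply: integrable_sumR.
apply: eq_bigr => k _; rewrite Rintegral_sum//; apply: eq_bigr => l _.
rewrite Rintegral_lin//.
- exact: (weight_cos _ _ cv).1.
- exact: (weight_sin _ _ cv).1.
Qed.

(** The weighted integral is the Gram form, bounded below by diagonal dominance; it is bounded above
    by the unweighted integral times [eta ^+ 8], the bound on the tensor weight over the square. *)
Lemma trig_observability eta N D p q : 0 < eta -> eta <= 1 -> (0 < D)%N ->
  16 * kappa <= D%:R * eta ^+ 4 -> (8 * D ^ 6 < N)%N ->
  eta ^+ 4 / (60 * kappa) * \sum_(k <- circle N) (p k ^+ 2 + q k ^+ 2) <=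
  \int[leb2]_(x in square eta)
    (trigR (circle N) p q x ^+ 2 + trigI (circle N) p q x ^+ 2).
Proof.
move=> eta0 eta1 D0 De DN; set s := circle N.
have ms := measurable_square eta.
pose V := eta ^+ 5 / 30; pose c := eta ^+ 7 / kappa.
pose M (i : int) := bumpM eta (freq i).
have k32 := @kappa_ge32 R; have k0 : kappa != 0 :> R by rewrite gt_eqF//; lra.
have pi1 : 1 <= pi :> R by apply: le_trans (pi_ge2 R); rewrite ler1n.
have fr i : i != 0 -> 1 <= `|freq i|.
  move=> i0; rewrite /freq normrM; apply: mulr_ege1.
    by rewrite normrM gtr0_norm// (gtr0_norm (pi_gt0 R)); lra.
  by rewrite -intr_norm ler1z; lia.
have M0 i : 0 <= M i <= V by rewrite sqrtr_ge0 bumpM_le.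
have Mc i : i != 0 -> M i <= V - c by move=> /fr; exact: bumpM_near.
have MB i : i != 0 -> M i <= eta ^+ 3 / i%:~R ^+ 2.
  move=> i0; have fn0 : freq i != 0 by rewrite -normr_gt0 (lt_le_trans ltr01 (fr i i0)).
  apply: le_trans (bumpM_far eta0 fn0) _.
  have i2 : 0 < i%:~R ^+ 2 :> R by rewrite exprn_even_gt0//= intr_eq0.
  rewrite ler_pdivrMr ?exprn_even_gt0//= mulrAC ler_pdivlMr//.
  rewrite -mulrA mulrCA ler_pM2l ?exprn_gt0// /freq !exprMn ler_pM2r//.
  have : 1 <= pi ^+ 2 :> R by rewrite exprn_ege1.
  lra.
have e0 n : 0 < eta ^+ n by rewrite exprn_gt0.
have cV : 0 <= c <= V by exact: bump_gap_le.
pose wc m := \int[leb2]_(x in square eta) (bump eta x.1 * bump eta x.2 * cos (theta m x)).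
pose ws m := \int[leb2]_(x in square eta) (bump eta x.1 * bump eta x.2 * sin (theta m x)).
have cb := @continuous_bump _ eta.
have W1 t : waveI eta (bump eta) 1 0 t = bumpC eta t.
  by rewrite /waveI Rintegral_bump_wave mul1r mul0r addr0.
have W2 t : waveI eta (bump eta) 0 1 t = bumpS eta t.
  by rewrite /waveI Rintegral_bump_wave mul1r mul0r add0r.
have wcE m : wc m = bumpC eta (freq m.1) * bumpC eta (freq m.2) -
    bumpS eta (freq m.1) * bumpS eta (freq m.2).
  by rewrite /wc (weight_cos _ _ cb).2 !W1 !W2.
have wsE m : ws m = bumpS eta (freq m.1) * bumpC eta (freq m.2) +
    bumpC eta (freq m.1) * bumpS eta (freq m.2).
  by rewrite /ws (weight_sin _ _ cb).2 !W1 !W2.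
(* As a complex number the two-dimensional transform is the product of two one-dimensional ones, so
   the moduli multiply. *)
have wM m : wc m ^+ 2 + ws m ^+ 2 = (M m.1 * M m.2) ^+ 2.
  rewrite exprMn !sqr_sqrtr ?addr_ge0 ?sqr_ge0// wcE wsE; ring.
have wc0 : wc (0, 0) = V ^+ 2.
  rewrite wcE /= /freq mulr0 /bumpC /bumpS.
  have -> : \int[leb]_(t in `[0, eta[) (bump eta t * cos (0 * t)) = V.
    by under eq_Rintegral do rewrite mul0r cos0 mulr1; rewrite Rintegral_bump.
  have -> : \int[leb]_(t in `[0, eta[) (bump eta t * sin (0 * t)) = 0.
    by under eq_Rintegral do rewrite mul0r sin0 mulr0; rewrite Rintegral_cst// mul0r.
  by rewrite mulr0 subr0 expr2.
pose a k := p k ^+ 2 + q k ^+ 2.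
have a0 k : 0 <= a k by rewrite addr_ge0 ?sqr_ge0.
pose d k l : int * int := (k.1 - l.1, k.2 - l.2).
pose Q k l := (p k * p l + q k * q l) * wc (d k l) + (p k * q l - q k * p l) * ws (d k l).
have QV k : Q k k = V ^+ 2 * a k.
  by rewrite /Q /d !subrr wc0 /a; ring.
(* Cauchy-Schwarz for plane vectors bounds [Q k l] by the product of the moduli of the two
   coefficients and of the transform; the arithmetic-geometric mean inequality then gives
   [(a k + a l) / 2]. *)
have QW k l : k != l -> - ((a k + a l) / 2 * (M (k.1 - l.1) * M (k.2 - l.2))) <= Q k l.
  move=> _; set z := (a k + a l) / 2; set w := M _ * M _.
  have w0 : 0 <= w.
    have /andP[h1 _] := M0 (k.1 - l.1); have /andP[h2 _] := M0 (k.2 - l.2).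
    exact: mulr_ge0.
  have z0 : 0 <= z by rewrite divr_ge0// addr_ge0.
  suff : `|Q k l| <= z * w by rewrite ler_norml => /andP[].
  rewrite -ler_sqr ?nnegrE ?normr_ge0 ?(mulr_ge0 z0 w0)// real_normK ?num_real//.
  have : Q k l ^+ 2 <= ((p k * p l + q k * q l) ^+ 2 + (p k * q l - q k * p l) ^+ 2) *
      (wc (d k l) ^+ 2 + ws (d k l) ^+ 2).
    rewrite -subr_ge0 /Q; set X := (p k * p l + _); set Y := (p k * q l - _).
    rewrite [leRHS](_ : _ = (X * ws (d k l) - Y * wc (d k l)) ^+ 2) ?sqr_ge0//; ring.
  move/le_trans; apply; rewrite wM /d/= -/w [leRHS]exprMn ler_wpM2r ?sqr_ge0//.
  rewrite -subr_ge0 /z /a.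
  rewrite [leRHS](_ : _ = ((p k ^+ 2 + q k ^+ 2 - (p l ^+ 2 + q l ^+ 2)) / 2) ^+ 2) ?sqr_ge0//.
  by field.
have Wsym k l : M (k.1 - l.1) * M (k.2 - l.2) = M (l.1 - k.1) * M (l.2 - k.2).
  by rewrite /M -(bumpM_even _ (l.1 - k.1)) -(bumpM_even _ (l.2 - k.2)) !opprB.
have WG k : k \in s -> \sum_(l <- s | l != k) M (k.1 - l.1) * M (k.2 - l.2) <=
    V * (V - c) + 8 * V * eta ^+ 3 / D%:R.
  move=> ks; under eq_bigr do rewrite Wsym.
  by apply: circle_gershgorin => //; rewrite ltW.
have main := schur_lower (circle_uniq N) a0 QV QW Wsym WG.
have [iw Iw] := integrable_trig_sqr_weight eta s p q cb.
have c1 : continuous (fun _ : R => 1 : R) by move=> t; exact: cvg_cst.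
have [iu _] := integrable_trig_sqr_weight eta s p q c1.
have {}iu : leb2.-integrable (square eta)
    (EFin \o (fun x => trigR s p q x ^+ 2 + trigI s p q x ^+ 2)).
  apply: eq_integrable iu => // x _; by rewrite /= mulr1 mul1r.
set S := \sum_(k <- s) _; set J := Rintegral _ _ _.
have S0 : 0 <= S by apply: sumr_ge0 => k _; exact: a0.
have up : \sum_(k <- s) \sum_(l <- s) Q k l <= eta ^+ 8 * J.
  rewrite -Iw /J -RintegralZl//; apply: le_Rintegral => //.
    exact: (integrableZl ms (eta ^+ 8) iu).
  move=> x [/=]; rewrite !in_itv/= => /andP[h1 h2] /andP[h3 h4].
  rewrite ler_wpM2r ?addr_ge0 ?sqr_ge0//.
  have -> : eta ^+ 8 = eta ^+ 4 * eta ^+ 4 by ring.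
  by apply: ler_pM; rewrite ?bump_ge0 ?bump_le// ltW.
have DR : 0 < D%:R :> R by rewrite ltr0n.
(* Half of the margin [V * c] is kept, which gives 60 as [2 * 30]. The hypothesis with [16 * kappa]
   says exactly that the far entries cost at most the other half. *)
have VG : eta ^+ 12 / (60 * kappa) <= V ^+ 2 - (V * (V - c) + 8 * V * eta ^+ 3 / D%:R).
  have -> : V ^+ 2 - (V * (V - c) + 8 * V * eta ^+ 3 / D%:R) =
    V * (c - 8 * eta ^+ 3 / D%:R) by ring.
  have -> : eta ^+ 12 / (60 * kappa) = V * (eta ^+ 7 / (2 * kappa)) by rewrite /V; field.
  rewrite ler_wpM2l//; first by rewrite divr_ge0// ltW.
  suff : 8 * eta ^+ 3 / D%:R <= eta ^+ 7 / (2 * kappa) by rewrite /c; lra.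
  rewrite ler_pdivrMr//.
  have -> : eta ^+ 7 / (2 * kappa) * D%:R = eta ^+ 3 * (D%:R * eta ^+ 4 / (2 * kappa)) by field.
  rewrite mulrC ler_wpM2l ?(ltW (e0 _))// ler_pdivlMr; last by lra.
  by apply: le_trans De; rewrite mulrA -natrM.
have : eta ^+ 8 * (eta ^+ 4 / (60 * kappa) * S) <= eta ^+ 8 * J.
  apply: le_trans up; apply: le_trans main.
  have -> : eta ^+ 8 * (eta ^+ 4 / (60 * kappa) * S) = eta ^+ 12 / (60 * kappa) * S by field.
  exact: ler_wpM2r.
by rewrite ler_pM2l.
Qed.

End TrigonometricPolynomials.

(** * Square-integrable functions *)

Section RealL2.
Context d (T : measurableType d) (R : realType) (mu : {measure set T -> \bar R}).
Variable D : set T.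
Hypothesis mD : measurable D.
Local Notation Re := complex.Re.
Local Notation Im := complex.Im.
Implicit Types (f g h : T -> R[i]) (a b c : R) (m : T -> R).

Definition cdot (z w : R[i]) : R := Re z * Re w + Im z * Im w.

Lemma cdotC z w : cdot z w = cdot w z.
Proof. by rewrite /cdot; ring. Qed.

Lemma cdot_ge0 z : 0 <= cdot z z.
Proof. by rewrite /cdot -!expr2 addr_ge0 ?sqr_ge0. Qed.

(* Complex-valued functions form a real Hilbert space here: inner products are
   real parts of the Hermitian ones. *)
Definition lincomb a f b g : T -> R[i] := fun x =>
  Complex (a * Re (f x) + b * Re (g x)) (a * Im (f x) + b * Im (g x)).

Definition mulfun m f : T -> R[i] := fun x => Complex (m x * Re (f x)) (m x * Im (f x)).

(** Measurability is global, as in [L2], and only integrability refers to [D]; restricting to a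
    smaller square then needs no change of function. *)
Definition sqint f := [/\ measurable_fun setT (fun x => Re (f x)),
  measurable_fun setT (fun x => Im (f x)) &
  mu.-integrable D (EFin \o (fun x => cdot (f x) (f x)))].

Definition inner f g : R := \int[mu]_(x in D) cdot (f x) (g x).

Lemma measurable_cdot f g : measurable_fun setT (fun x => Re (f x)) ->
  measurable_fun setT (fun x => Im (f x)) ->
  measurable_fun setT (fun x => Re (g x)) ->
  measurable_fun setT (fun x => Im (g x)) ->
  measurable_fun setT (fun x => cdot (f x) (g x)).
Proof.
by move=> *; apply: measurable_funD; exact: measurable_funM.
Qed.

Let dominated_integrable (F G : T -> R) : measurable_fun setT F ->
  mu.-integrable D (EFin \o G) -> (forall x, `|F x| <= G x) ->
  mu.-integrable D (EFin \o F).
Proof.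
move=> mF iG FG; apply: le_integrable iG => //.
  apply/measurable_EFinP; exact: measurable_funTS.
by move=> x _; rewrite lee_fin (le_trans (FG x))// ler_norm.
Qed.

Lemma sqint_cdot f g : sqint f -> sqint g ->
  mu.-integrable D (EFin \o (fun x => cdot (f x) (g x))).
Proof.
move=> [f1 f2 fi] [g1 g2 gi].
apply: (@dominated_integrable _ (fun x => 1 * cdot (f x) (f x) + 1 * cdot (g x) (g x))).
- exact: measurable_cdot.
- exact: integrable_lin.
move=> x; rewrite !mul1r /cdot; case: (f x) (g x) => [p q] [r s] /=.
rewrite ler_norml; apply/andP; split; rewrite -subr_ge0.
  rewrite [leRHS](_ : _ = (p + r) ^+ 2 / 2 + (q + s) ^+ 2 / 2 +
    (p ^+ 2 + q ^+ 2 + r ^+ 2 + s ^+ 2) / 2); last by field.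
  by rewrite !addr_ge0// divr_ge0// ?addr_ge0// ?sqr_ge0.
rewrite [leRHS](_ : _ = (p - r) ^+ 2 / 2 + (q - s) ^+ 2 / 2 +
  (p ^+ 2 + q ^+ 2 + r ^+ 2 + s ^+ 2) / 2); last by field.
by rewrite !addr_ge0// divr_ge0// ?addr_ge0// ?sqr_ge0.
Qed.

Lemma sqint_lincomb a f b g : sqint f -> sqint g -> sqint (lincomb a f b g).
Proof.
move=> [f1 f2 fi] [g1 g2 gi].
have m1 : measurable_fun setT (fun x => Re (lincomb a f b g x)).
  by apply: measurable_funD; apply: measurable_funM => //; exact: measurable_cst.
have m2 : measurable_fun setT (fun x => Im (lincomb a f b g x)).
  by apply: measurable_funD; apply: measurable_funM => //; exact: measurable_cst.
split => //.
apply: (@dominated_integrable _ (fun x => (2 * a ^+ 2) * cdot (f x) (f x) +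
    (2 * b ^+ 2) * cdot (g x) (g x))).
- exact: measurable_cdot.
- exact: integrable_lin.
move=> x; rewrite ger0_norm ?cdot_ge0// /cdot/= -subr_ge0.
case: (f x) (g x) => [p q] [r s] /=.
rewrite [leRHS](_ : _ = (a * p - b * r) ^+ 2 + (a * q - b * s) ^+ 2); last by ring.
by rewrite addr_ge0 ?sqr_ge0.
Qed.

Lemma sqint_mulfun m f c : measurable_fun setT m -> (forall x, `|m x| <= c) ->
  sqint f -> sqint (mulfun m f).
Proof.
move=> mm mc [f1 f2 fi].
have m1 : measurable_fun setT (fun x => Re (mulfun m f x)) by exact: measurable_funM.
have m2 : measurable_fun setT (fun x => Im (mulfun m f x)) by exact: measurable_funM.
split => //.
apply: (@dominated_integrable _ (fun x => c ^+ 2 * cdot (f x) (f x) + 0 * cdot (f x) (f x))).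
- exact: measurable_cdot.
- exact: integrable_lin.
move=> x; rewrite ger0_norm ?cdot_ge0// mul0r addr0.
have -> : cdot (mulfun m f x) (mulfun m f x) = `|m x| ^+ 2 * cdot (f x) (f x).
  by rewrite real_normK ?num_real// /cdot/=; ring.
by rewrite ler_wpM2r ?cdot_ge0// ler_sqr ?nnegrE// (le_trans _ (mc x)).
Qed.

Lemma innerC f g : inner f g = inner g f.
Proof. by apply: eq_Rintegral => x _; rewrite cdotC. Qed.

Lemma inner_lincombl a f b g h : sqint f -> sqint g -> sqint h ->
  inner (lincomb a f b g) h = a * inner f h + b * inner g h.
Proof.
move=> sf sg sh; rewrite /inner -Rintegral_lin//; last 2 first.
- exact: sqint_cdot.
- exact: sqint_cdot.
by apply: eq_Rintegral => x _; rewrite /cdot/=; ring.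
Qed.

Lemma inner_lincombr a f b g h : sqint f -> sqint g -> sqint h ->
  inner h (lincomb a f b g) = a * inner h f + b * inner h g.
Proof. by move=> *; rewrite innerC inner_lincombl// !(innerC h). Qed.

Lemma inner_mulfun m f g : inner (mulfun m f) g = inner f (mulfun m g).
Proof. by apply: eq_Rintegral => x _; rewrite /cdot/=; ring. Qed.

Lemma inner_ge0 f : 0 <= inner f f.
Proof. by apply: Rintegral_ge0 => x _; exact: cdot_ge0. Qed.

Lemma inner_le2 f g : sqint f -> sqint g -> 2 * inner f g <= inner f f + inner g g.
Proof.
move=> sf sg; rewrite -subr_ge0.
have := inner_ge0 (lincomb 1 f (-1) g).
have s1 := sqint_lincomb 1 (-1) sf sg.
rewrite inner_lincombl// !inner_lincombr// (innerC g f); lra.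
Qed.

Section Orthonormal.
Variables (I : eqType) (E : I -> T -> R[i]).
Hypothesis sE : forall i, sqint (E i).
Hypothesis orthoE : forall i j, inner (E i) (E j) = (i == j)%:R.
Implicit Types (s : seq I) (u F : T -> R[i]).

Fixpoint proj s u : T -> R[i] :=
  if s is i :: s' then lincomb (inner u (E i)) (E i) 1 (proj s' u) else fun=> Complex 0 0.

Lemma projE s u x : proj s u x = Complex (\sum_(i <- s) inner u (E i) * Re (E i x))
  (\sum_(i <- s) inner u (E i) * Im (E i x)).
Proof.
elim: s => [|i s IH]/=; first by rewrite !big_nil.
by rewrite /lincomb IH/= !big_cons !mul1r.
Qed.

Lemma sqint0 : sqint (fun=> Complex 0 0).
Proof.
split; [exact: measurable_cst|exact: measurable_cst|].
have := integrable0 mu D; congr integrable; apply/funext => x.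
by rewrite /= /cdot/= mulr0 addr0.
Qed.

Lemma sqint_proj s u : sqint (proj s u).
Proof. by elim: s => [|i s IH]/=; [exact: sqint0|exact: sqint_lincomb]. Qed.

Lemma inner_proj s u g : sqint g ->
  inner (proj s u) g = \sum_(i <- s) inner u (E i) * inner (E i) g.
Proof.
move=> sg; elim: s => [|i s IH]/=.
  rewrite big_nil /inner; under eq_Rintegral do rewrite /cdot/= !mul0r addr0.
  by rewrite Rintegral_cst// mul0r.
by rewrite inner_lincombl ?IH ?big_cons ?mul1r//; exact: sqint_proj.
Qed.

Lemma inner_proj_basis s u j : uniq s -> j \in s -> inner (proj s u) (E j) = inner u (E j).
Proof.
move=> us js; rewrite inner_proj//.
rewrite (bigD1_seq j)//= orthoE eqxx mulr1 big1 ?addr0// => i /negPf ij.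
by rewrite orthoE ij mulr0.
Qed.

Definition resid s u := lincomb 1 u (-1) (proj s u).

Lemma sqint_resid s u : sqint u -> sqint (resid s u).
Proof. by move=> su; apply: sqint_lincomb => //; exact: sqint_proj. Qed.

Lemma inner_resid_basis s u j : sqint u -> uniq s -> j \in s -> inner (resid s u) (E j) = 0.
Proof.
move=> su us js; rewrite inner_lincombl//; last exact: sqint_proj.
by rewrite inner_proj_basis// mul1r mulN1r subrr.
Qed.

Lemma inner_resid s u : sqint u -> uniq s ->
  inner (resid s u) (resid s u) = inner u u - \sum_(i <- s) inner u (E i) ^+ 2.
Proof.
move=> su us; have sp := sqint_proj s u; have sr := sqint_resid s su.
have rp : inner (resid s u) (proj s u) = 0.
  rewrite innerC inner_proj// big_seq big1// => i is'.
  by rewrite (innerC (E i)) inner_resid_basis// mulr0.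
have e : inner (resid s u) (resid s u) = inner (resid s u) u.
  by rewrite {2}/resid inner_lincombr// rp mul1r mulr0 addr0.
rewrite e inner_lincombl// inner_proj// mul1r mulN1r; congr (_ - _).
by apply: eq_bigr => i _; rewrite (innerC (E i)) expr2.
Qed.

Lemma bessel s u : sqint u -> uniq s -> \sum_(i <- s) inner u (E i) ^+ 2 <= inner u u.
Proof. by move=> su us; have := inner_ge0 (resid s u); rewrite inner_resid// subr_ge0. Qed.

(* Membership in the finite span of the E i, phrased through orthogonality so
   that products with trigonometric functions need no coefficient bookkeeping. *)
Definition in_span (P : T -> R[i]) := sqint P /\ exists s : seq I,
  forall g, sqint g -> (forall i, i \in s -> inner g (E i) = 0) -> inner g P = 0.

Definition approximable u := sqint u /\ forall e : R, 0 < e ->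
  exists2 P, in_span P & inner (lincomb 1 u (-1) P) (lincomb 1 u (-1) P) < e.

(** Parseval up to [e]. Once [s] contains the frequencies of an approximant [P], the residual r is
    orthogonal to [P] and to the projection, so its squared norm is the inner product of r with
    [u - P], and hence at most the squared norm of [u - P]. Including [s0] allows a prescribed set
    of frequencies. *)
Lemma approximable_bessel u s0 (e : R) : approximable u -> 0 < e ->
  exists s, [/\ uniq s, {subset s0 <= s} &
    inner u u <= \sum_(i <- s) inner u (E i) ^+ 2 + e].
Proof.
move=> [su au] e0; have [P [sP [s1 s1P]] Pe] := au _ e0.
exists (undup (s1 ++ s0)); split; first exact: undup_uniq.
  by move=> i i0; rewrite mem_undup mem_cat i0 orbT.
set s := undup _; have us : uniq s by exact: undup_uniq.
have sr := sqint_resid s su; have sp := sqint_proj s u.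
have suP := sqint_lincomb 1 (-1) su sP.
have rP : inner (resid s u) P = 0.
  apply: s1P => // i is1; apply: inner_resid_basis => //.
  by rewrite mem_undup mem_cat is1.
have rp : inner (resid s u) (proj s u) = 0.
  rewrite innerC inner_proj// big_seq big1// => i is'.
  by rewrite (innerC (E i)) inner_resid_basis// mulr0.
have e1 : inner (resid s u) (resid s u) = inner (resid s u) (lincomb 1 u (-1) P).
  by rewrite {2}/resid !inner_lincombr// rP rp !mulr0.
have := inner_le2 sr suP; rewrite -e1.
have := inner_resid su us; lra.
Qed.

(** The coefficients of [u] off [Z] are compared termwise with those of [F]. Density enters only
    through [u]; for [F] Bessel's inequality suffices. *)
Lemma resid_le u F (Z : pred I) (sZ : seq I) : approximable u -> sqint F ->
  uniq sZ -> (forall i, (i \in sZ) = Z i) ->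
  (forall i, ~~ Z i -> inner u (E i) ^+ 2 <= inner F (E i) ^+ 2) ->
  inner (resid sZ u) (resid sZ u) <= inner F F.
Proof.
move=> au sF uZ mZ uF; have su := au.1.
apply/ler_addgt0Pr => e e0.
have [s [us sZs ule]] := approximable_bessel sZ au e0.
rewrite inner_resid//.
have : \sum_(i <- s) inner u (E i) ^+ 2 =
    \sum_(i <- sZ) inner u (E i) ^+ 2 + \sum_(i <- s | ~~ Z i) inner u (E i) ^+ 2.
  rewrite (bigID Z)/=; congr (_ + _); rewrite -big_filter.
  apply: perm_big; apply: uniq_perm => //; first exact: filter_uniq.
  by move=> i; rewrite mem_filter mZ andb_idr// -mZ => /sZs.
have : \sum_(i <- s | ~~ Z i) inner u (E i) ^+ 2 <= \sum_(i <- s) inner F (E i) ^+ 2.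
  rewrite [leRHS](bigID Z)/= -[leLHS]add0r lerD//; last exact: ler_sum.
  by apply: sumr_ge0 => i _; rewrite sqr_ge0.
have := bessel sF us; lra.
Qed.

End Orthonormal.
End RealL2.

(** * Multipliers of the closed span *)

Section Density.
Context d (T : measurableType d) (R : realType) (mu : {measure set T -> \bar R}).
Variable D : set T.
Hypothesis mD : measurable D.
Local Notation Re := complex.Re.
Local Notation Im := complex.Im.
Variables (I : eqType) (E : I -> T -> R[i]).
Hypothesis sE : forall i, sqint mu D (E i).
Implicit Types (f g h : T -> R[i]) (a b c : R) (m : T -> R).
Local Notation sqint := (sqint mu D).
Local Notation ip := (inner mu D).
Local Notation in_span := (in_span mu D E).
Local Notation approximable := (approximable mu D E).

Lemma in_span_basis i : in_span (E i).
Proof. by split=> //; exists [:: i] => g _; apply; rewrite mem_head. Qed.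

Lemma in_span_lincomb a f b g : in_span f -> in_span g -> in_span (lincomb a f b g).
Proof.
move=> [sf [s1 h1]] [sg [s2 h2]]; split; first exact: sqint_lincomb.
exists (s1 ++ s2) => k sk kE; rewrite inner_lincombr//.
rewrite h1 ?h2 ?mulr0 ?addr0// => i i2; apply: kE.
  by rewrite mem_cat i2 orbT.
by rewrite mem_cat i2.
Qed.

Lemma in_span_approximable f : in_span f -> approximable f.
Proof.
move=> hf; have [sf _] := hf; split=> // e e0; exists f => //.
rewrite (_ : ip _ _ = 0)// /inner.
under eq_Rintegral do rewrite /cdot/= !mulN1r !mul1r !subrr !mulr0 addr0.
by rewrite Rintegral_cst// mul0r.
Qed.

Lemma inner_lincomb_le a f b g : sqint f -> sqint g ->
  ip (lincomb a f b g) (lincomb a f b g) <= 2 * a ^+ 2 * ip f f + 2 * b ^+ 2 * ip g g.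
Proof.
move=> sf sg; have := inner_ge0 mu D (lincomb a f (- b) g).
have s1 := sqint_lincomb mD a (- b) sf sg; have s2 := sqint_lincomb mD a b sf sg.
rewrite !inner_lincombl// !inner_lincombr// (innerC _ _ g f) => h; rewrite -subr_ge0.
by apply: le_trans h _; rewrite le_eqVlt; apply/orP; left; apply/eqP; ring.
Qed.

Lemma approximable_lim f : sqint f ->
  (forall e, 0 < e -> exists2 g, approximable g &
    ip (lincomb 1 f (-1) g) (lincomb 1 f (-1) g) < e) -> approximable f.
Proof.
move=> sf hf; split=> // e e0.
have e4 : 0 < e / 4 by rewrite divr_gt0.
have [g [sg ag] ge] := hf _ e4; have [P PP Pe] := ag _ e4.
exists P => //; have [sP _] := PP.
rewrite (_ : lincomb 1 f (-1) P =
    lincomb 1 (lincomb 1 f (-1) g) 1 (lincomb 1 g (-1) P)); last first.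
  by apply/funext => x; rewrite /lincomb/=; congr Complex; ring.
apply: le_lt_trans (inner_lincomb_le _ _ _ _) _; try exact: sqint_lincomb.
lra.
Qed.

Lemma approximable_lincomb a f b g :
  approximable f -> approximable g -> approximable (lincomb a f b g).
Proof.
move=> [sf af] [sg ag]; split; first exact: sqint_lincomb.
move=> e e0; set k := 2 * a ^+ 2 + 2 * b ^+ 2 + 1.
have a2 := sqr_ge0 a; have b2 := sqr_ge0 b.
have k0 : 0 < k by rewrite /k; lra.
have ek : 0 < e / k by rewrite divr_gt0.
have [P PP Pe] := af _ ek; have [Q QQ Qe] := ag _ ek.
have [sP _] := PP; have [sQ _] := QQ.
exists (lincomb a P b Q); first exact: in_span_lincomb.
rewrite (_ : lincomb 1 _ _ _ = lincomb a (lincomb 1 f (-1) P) b (lincomb 1 g (-1) Q)); last first.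
  by apply/funext => x; rewrite /lincomb/=; congr Complex; ring.
apply: le_lt_trans (inner_lincomb_le _ _ _ _) _; try exact: sqint_lincomb.
apply: (@le_lt_trans _ _ ((k - 1) * (e / k))).
  have -> : k - 1 = 2 * a ^+ 2 + 2 * b ^+ 2 by rewrite /k; ring.
  by rewrite [leRHS]mulrDl; apply: lerD; (apply: ler_wpM2l; [rewrite mulr_ge0|exact: ltW]).
by rewrite mulrBl mul1r mulrC divfK ?gt_eqF// ltrBlDr ltrDl.
Qed.

Lemma approximable_cvg (u : (T -> R[i])^nat) f (G : T -> R) : sqint f ->
  (forall n, approximable (u n)) -> mu.-integrable D (EFin \o G) ->
  (forall n x, D x -> cdot (lincomb 1 f (-1) (u n) x) (lincomb 1 f (-1) (u n) x) <= G x) ->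
  (forall x, D x ->
     cdot (lincomb 1 f (-1) (u n) x) (lincomb 1 f (-1) (u n) x) @[n --> \oo] --> (0 : R)) ->
  approximable f.
Proof.
move=> sf au iG uG u0; apply: approximable_lim => // e e0.
have su n : sqint (lincomb 1 f (-1) (u n)) by apply: sqint_lincomb => //; have [] := au n.
pose F n x := (cdot (lincomb 1 f (-1) (u n) x) (lincomb 1 f (-1) (u n) x))%:E.
have [_ _ F0] : [/\ mu.-integrable D (cst 0%E),
    [sequence \int[mu]_(x in D) `|F n x - 0|%E]_n @ \oo --> 0%E &
    [sequence \int[mu]_(x in D) F n x]_n @ \oo --> \int[mu]_(x in D) (cst 0%E) x]%E.
  apply: (@dominated_convergence _ _ _ _ _ mD F (cst 0%E) (EFin \o G)) => //.
  - by move=> n; have [m1 m2 _] := su n;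
      apply/measurable_EFinP; apply: measurable_funTS; exact: measurable_cdot.
  - by apply: aeW => x Dx; apply: cvg_EFin; [exact: nearW|exact: u0].
  - by apply: aeW => x n Dx; rewrite /F gee0_abs ?lee_fin ?cdot_ge0// uG.
move: F0; rewrite integral0 => /fine_cvgP[_] /cvgrPdist_lt/(_ _ e0)[n _ /(_ n (leqnn n))].
rewrite sub0r normrN /= => ne; exists (u n); first exact: au.
exact: le_lt_trans (ler_norm _) ne.
Qed.

(** Multipliers form an algebra closed under bounded pointwise limits, which reduces density to a
    supply of explicit multipliers and to constants being approximable. *)
Definition multiplier m := [/\ measurable_fun setT m,
  (exists c, forall x, `|m x| <= c) &
  forall f, approximable f -> approximable (mulfun m f)].

Lemma multiplier_cst c : multiplier (cst c).
Proof.
split; first exact: measurable_cst.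
  by exists `|c| => x.
move=> f af; rewrite (_ : mulfun _ _ = lincomb c f 0 f); first exact: approximable_lincomb.
by apply/funext => x; rewrite /mulfun /lincomb !mul0r !addr0.
Qed.

Lemma multiplierD m1 m2 : multiplier m1 -> multiplier m2 ->
  multiplier (fun x => m1 x + m2 x).
Proof.
move=> [mm1 [c1 b1] h1] [mm2 [c2 b2] h2]; split; first exact: measurable_funD.
  by exists (c1 + c2) => x; rewrite (le_trans (ler_normD _ _))// lerD.
move=> f af; rewrite (_ : mulfun _ _ = lincomb 1 (mulfun m1 f) 1 (mulfun m2 f)).
  by apply: approximable_lincomb; [exact: h1|exact: h2].
by apply/funext => x; rewrite /mulfun /lincomb/= !mul1r !mulrDl.
Qed.

Lemma multiplierM m1 m2 : multiplier m1 -> multiplier m2 ->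
  multiplier (fun x => m1 x * m2 x).
Proof.
move=> [mm1 [c1 b1] h1] [mm2 [c2 b2] h2]; split; first exact: measurable_funM.
  by exists (c1 * c2) => x; rewrite normrM ler_pM.
move=> f af; rewrite (_ : mulfun _ _ = mulfun m1 (mulfun m2 f)).
  by apply: h1; exact: h2.
by apply/funext => x; rewrite /mulfun /= !mulrA.
Qed.

Lemma multiplierX m n : multiplier m -> multiplier (fun x => m x ^+ n).
Proof.
move=> hm; elim: n => [|n IH].
  by under eq_fun do rewrite expr0; exact: multiplier_cst.
by under eq_fun do rewrite exprS; exact: multiplierM.
Qed.

Lemma multiplierC m : multiplier m -> multiplier (fun x => 1 - m x).
Proof.
move=> hm; rewrite (_ : (fun x => _) = fun x => cst 1 x + cst (-1) x * m x).
  by apply: multiplierD; [exact: multiplier_cst|apply: multiplierM => //; exact: multiplier_cst].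
by apply/funext => x; rewrite mulN1r.
Qed.

Lemma multiplier_sum (J : Type) (s : seq J) (m : J -> T -> R) :
  (forall j, multiplier (m j)) -> multiplier (fun x => \sum_(j <- s) m j x).
Proof.
move=> hm; elim: s => [|j s IH].
  by under eq_fun do rewrite big_nil; exact: multiplier_cst.
by under eq_fun do rewrite big_cons; exact: multiplierD.
Qed.

(** Dominated convergence, with [(2 * c) ^+ 2] times the squared modulus of [f] as dominating
    function. The sequence is controlled on [D] only: periodic functions can approximate a half
    plane inside the cell but not beyond it. *)
Lemma multiplier_cvg (u : (T -> R)^nat) m c : (forall n, multiplier (u n)) ->
  measurable_fun setT m -> (forall x, `|m x| <= c) -> 
  (forall n x, D x -> `|u n x| <= c) ->
  (forall x, D x -> u n x @[n --> \oo] --> m x) -> multiplier m.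
Proof.
move=> hu mm mc uc um; split=> //; first by exists c.
move=> f af; have [sf _] := af; have [_ _ fi] := sf.
apply: (@approximable_cvg (fun n => mulfun (u n) f) _
    (fun x => (2 * c) ^+ 2 * cdot (f x) (f x) + 0 * cdot (f x) (f x))).
- exact: sqint_mulfun mc _.
- by move=> n; have [_ _] := hu n; apply.
- exact: integrable_lin.
- move=> n x Dx; rewrite mul0r addr0.
  have -> : cdot (lincomb 1 (mulfun m f) (-1) (mulfun (u n) f) x)
      (lincomb 1 (mulfun m f) (-1) (mulfun (u n) f) x) = `|m x - u n x| ^+ 2 * cdot (f x) (f x).
    by rewrite real_normK ?num_real// /cdot/=; ring.
  rewrite ler_wpM2r ?cdot_ge0// ler_sqr ?nnegrE//.
    by rewrite (le_trans (ler_normB _ _))// mulr_natl mulr2n lerD// uc.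
  by rewrite mulr_ge0// (le_trans _ (mc x)).
- move=> x Dx.
  rewrite (_ : (fun n => _) = fun n => (m x - u n x) ^+ 2 * cdot (f x) (f x)); last first.
    by apply/funext => n; rewrite /cdot/=; ring.
  have : (m x - u n x) ^+ 2 * cdot (f x) (f x) @[n --> \oo] -->
      (m x - m x) ^+ 2 * cdot (f x) (f x).
    apply: cvgMl; apply: cvgM; apply: cvgB; try exact: cvg_cst; exact: um.
  by rewrite subrr expr0n mul0r.
Qed.

(** Multiplication by a real function is self-adjoint, so orthogonality conditions for [mulfun m P]
    are conditions on finitely many [mulfun m (E i)]; as [m] is bounded by 1 it is a contraction,
    and the property passes to the closure. *)
Lemma multiplier_of_basis m : measurable_fun setT m -> (forall x, `|m x| <= 1) ->
  (forall i, in_span (mulfun m (E i))) -> multiplier m.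
Proof.
move=> mm m1 mE; split=> //; first by exists 1.
have ms f : sqint f -> sqint (mulfun m f) by exact: sqint_mulfun m1.
have mspan P : in_span P -> in_span (mulfun m P).
  move=> [sP [s sPs]]; split; first exact: ms.
  have [s' hs'] : exists s' : seq I, forall g, sqint g -> (forall i, i \in s' -> ip g (E i) = 0) ->
      forall i, i \in s -> ip g (mulfun m (E i)) = 0.
    elim: s {sPs} => [|i s [s' IH]]; first by exists [::].
    have [_ [t ht]] := mE i; exists (t ++ s') => g sg gE j.
    rewrite inE => /orP[/eqP ->|js].
      by apply: ht => // k kt; apply: gE; rewrite mem_cat kt.
    by apply: IH => // k kt; apply: gE; rewrite mem_cat kt orbT.
  exists s' => g sg gE; rewrite -inner_mulfun; apply: sPs => [|i si]; first exact: ms.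
  by rewrite inner_mulfun; exact: hs'.
move=> f [sf af]; split=> [|e e0]; first exact: ms.
have [P PP Pe] := af _ e0; have [sP _] := PP.
exists (mulfun m P); first exact: mspan.
apply: le_lt_trans Pe; have s1 := sqint_lincomb mD 1 (-1) sf sP.
rewrite (_ : lincomb 1 (mulfun m f) (-1) (mulfun m P) = mulfun m (lincomb 1 f (-1) P)); last first.
  by apply/funext => x; rewrite /mulfun /lincomb/=; congr Complex; ring.
apply: le_Rintegral => //.
- by apply: sqint_cdot => //; exact: ms.
- exact: sqint_cdot.
move=> x _.
have -> : cdot (mulfun m (lincomb 1 f (-1) P) x) (mulfun m (lincomb 1 f (-1) P) x) =
    `|m x| ^+ 2 * cdot (lincomb 1 f (-1) P x) (lincomb 1 f (-1) P x).
  by rewrite real_normK ?num_real// /cdot/=; ring.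
by rewrite ler_piMl ?cdot_ge0// exprn_ile1.
Qed.

Definition mult_set : set (set T) :=
  [set A | measurable A /\ multiplier (\1_A : T -> R)].

Lemma mult_set_sigma_algebra : sigma_algebra setT mult_set.
Proof.
split.
- split; first exact: measurable0.
  rewrite indic0; exact: multiplier_cst.
- move=> A [mA hA]; rewrite setTD; split; first exact: measurableC.
  rewrite (_ : \1__ = fun x => 1 - \1_A x); first exact: multiplierC.
  by apply/funext => x; rewrite !indicE in_setC; case: (x \in A); rewrite ?subrr ?subr0.
- move=> A hA; split; first by apply: bigcup_measurable => n _; exact: (hA n).1.
  (* This is the indicator of the union of the first [n] sets, written with products and complements
     so that closure under the algebra operations applies. *)
  pose u n x : R := 1 - \prod_(k < n) (1 - \1_(A k) x).
  have mu0 n : multiplier (fun x => \prod_(k < n) (1 - \1_(A k) x)).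
    elim: n => [|n IH].
      by under eq_fun do rewrite big_ord0; exact: multiplier_cst.
    under eq_fun do rewrite big_ord_recr.
    by apply: multiplierM => //; apply: multiplierC; exact: (hA n).2.
  have uE n x : u n x = (`[< exists2 k, (k < n)%N & A k x >])%:R.
    rewrite /u; elim: n => [|n IH].
      by rewrite big_ord0 subrr; case: asboolP => // -[].
    rewrite big_ord_recr/= {1}indicE.
    have [xA|xA] := boolP (x \in A n).
      rewrite /= subrr mulr0 subr0; case: asboolP => // -[]; exists n => //.
      exact: set_mem.
    rewrite subr0 mulr1 IH; congr (nat_of_bool _)%:R.
    apply/asboolP/asboolP => -[k kn Ak]; exists k => //; first exact: ltnW.
    move: kn; rewrite ltnS leq_eqVlt => /orP[/eqP kn|//].
    by move: xA; rewrite notin_setE -kn.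
  apply: (@multiplier_cvg u _ 1).
  + by move=> n; exact: multiplierC.
  + apply: measurable_indic; apply: bigcup_measurable => n _; exact: (hA n).1.
  + by move=> x; rewrite indicE; case: (_ \in _); rewrite ?normr0 ?normr1.
  + by move=> n x _; rewrite uE; case: asboolP; rewrite ?normr0 ?normr1.
  + move=> x _; have [[k _ Ak]|nA] := pselect ((\bigcup_k A k) x).
      rewrite indicE mem_set; last by exists k.
      apply: cvg_near_cst; exists k.+1 => // n /= kn; rewrite uE.
      by case: asboolP => // -[]; exists k.
    rewrite indicE memNset//; apply: cvg_near_cst; near=> n; rewrite uE.
    by case: asboolP => // -[k _ Ak]; case: nA; exists k.
Unshelve. all: by end_near. Qed.

Hypothesis mult_measurable : forall A : set T, measurable A -> multiplier (\1_A : T -> R).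
Hypothesis approx_cst : forall z : R[i], approximable (cst z).

Import HBNNSimple.

Lemma multiplier_nnsfun (g : {nnsfun T >-> R}) : multiplier g.
Proof.
rewrite (_ : (g : T -> R) = fun x =>
    \sum_(y <- finmap.enum_fset (fset_set (range g)))
      (cst y x * \1_(g @^-1` [set y]) x)); last first.
  by apply/funext => x; rewrite fimfunE fsbig_finite.
apply: multiplier_sum => y; apply: multiplierM; first exact: multiplier_cst.
exact: mult_measurable.
Qed.

Lemma approximable_nonneg (F : T -> R) (z : R[i]) : measurable_fun setT F ->
  (forall x, 0 <= F x) -> mu.-integrable D (EFin \o (fun x => F x ^+ 2)) ->
  approximable (mulfun F (cst z)).
Proof.
move=> mF F0 iF; have mFE : measurable_fun setT (EFin \o F) by exact/measurable_EFinP.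
pose u n := nnsfun_approx measurableT mFE n.
have uF n x : 0 <= u n x <= F x.
  rewrite fun_ge0/= -lee_fin /u nnsfun_approxE.
  by apply: le_approx => // y _; rewrite lee_fin.
apply: (@approximable_cvg (fun n => mulfun (u n) (cst z)) _
   (fun x => cdot z z * F x ^+ 2 + 0 * F x ^+ 2)).
- have [h1 h2] : measurable_fun setT (fun x => F x * Re z) /\
      measurable_fun setT (fun x => F x * Im z).
    by split; apply: measurable_funM => //; exact: measurable_cst.
  split => //; have := integrable_lin (cdot z z) 0 mD iF iF; congr integrable.
  by apply/funext => x /=; congr EFin; rewrite /cdot/=; ring.
- move=> n; have [_ _] := multiplier_nnsfun (u n); apply; exact: approx_cst.
- exact: integrable_lin.
- move=> n x _; have /andP[h1 h2] := uF n x.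
  rewrite (_ : cdot _ _ = cdot z z * (F x - u n x) ^+ 2); last by rewrite /cdot/=; ring.
  rewrite mul0r addr0 ler_wpM2l ?cdot_ge0// ler_sqr ?nnegrE ?subr_ge0//.
  by rewrite lerBlDr lerDl.
- move=> x _.
  have uFx : u n x @[n --> \oo] --> F x.
    have := @cvg_nnsfun_approx _ _ _ _ measurableT _ mFE (fun x _ => F0 x) x Logic.I.
    by move/fine_cvgP => [].
  rewrite (_ : (fun n => _) = fun n => cdot z z * (F x - u n x) ^+ 2); last first.
    by apply/funext => n; rewrite /cdot/=; ring.
  have : cdot z z * (F x - u n x) ^+ 2 @[n --> \oo] --> cdot z z * (F x - F x) ^+ 2.
    apply: cvgMr; apply: cvgM; apply: cvgB; try exact: cvg_cst; exact: uFx.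
  by rewrite subrr expr0n mulr0.
Qed.

(** The real and imaginary parts are split into positive and negative parts, each a limit of simple
    functions, that is of multipliers applied to constants. *)
Lemma approximable_sqint f : sqint f -> approximable f.
Proof.
move=> [f1 f2 fi].
have aux (F : T -> R) z : measurable_fun setT F ->
    (forall x, F x ^+ 2 <= cdot (f x) (f x)) -> approximable (mulfun F (cst z)).
  move=> mF Ff.
  have sub (G : T -> R) : measurable_fun setT G -> (forall x, 0 <= G x <= `|F x|) ->
      approximable (mulfun G (cst z)).
    move=> mG GF; apply: approximable_nonneg => //.
      by move=> x; case/andP: (GF x).
    apply: le_integrable fi => //.
      apply/measurable_EFinP; apply: measurable_funTS; exact: measurable_funX.
    move=> x _; rewrite lee_fin ger0_norm ?sqr_ge0// ger0_norm ?cdot_ge0//.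
    apply: le_trans (Ff x); rewrite -[leRHS]real_normK ?num_real//.
    by have /andP[h1 h2] := GF x; rewrite ler_sqr ?nnegrE.
  rewrite (_ : mulfun F _ = lincomb 1 (mulfun F^\+ (cst z)) (-1) (mulfun F^\- (cst z))).
    apply: approximable_lincomb; apply: sub.
    - exact: measurable_funrpos.
    - by move=> x; rewrite funrpos_ge0 /funrpos ge_max ler_norm normr_ge0.
    - exact: measurable_funrneg.
    - by move=> x; rewrite funrneg_ge0 /funrneg ge_max -normrN ler_norm normr_ge0.
  apply/funext => x; rewrite /mulfun /lincomb/= !mul1r !mulN1r -!mulrBl.
  have -> : F^\+ x - F^\- x = F x.
    rewrite /funrpos /funrneg; have /orP[h|h] := le_total 0 (F x).
      by rewrite max_l// max_r ?oppr_le0// subr0.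
    by rewrite max_r// max_l ?oppr_ge0// sub0r opprK.
  by [].
rewrite (_ : f = lincomb 1 (mulfun (fun x => Re (f x)) (cst (Complex 1 0)))
    1 (mulfun (fun x => Im (f x)) (cst (Complex 0 1)))).
  apply: approximable_lincomb; apply: aux => // x.
  - by rewrite /cdot -!expr2 lerDl sqr_ge0.
  - by rewrite /cdot -!expr2 lerDr sqr_ge0.
by apply/funext => x; rewrite /mulfun /lincomb/= !(mulr0, mulr1, mul1r, addr0, add0r); case: (f x).
Qed.

End Density.

(** * Density of trigonometric polynomials *)

Section Steep.
Context {R : realType}.
Implicit Types (s y z : R) (n M : nat).

Lemma bernoulli_ge y M : -1 <= y -> 1 + M%:R * y <= (1 + y) ^+ M.
Proof.
move=> y1; elim: M => [|M IH]; first by rewrite mul0r addr0 expr0.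
rewrite exprS; apply: le_trans (ler_wpM2l _ IH); last by lra.
rewrite -[M.+1]addn1 natrD -subr_ge0.
rewrite [leRHS](_ : _ = M%:R * y ^+ 2); last by ring.
by rewrite mulr_ge0// sqr_ge0.
Qed.

(** In the geometric sum [1 - y ^+ n] equals [1 - y] times [n] terms, each at least [y ^+ n]. *)
Lemma natr_expr_le y n : 0 <= y -> y < 1 -> n%:R * (1 - y) * y ^+ n <= 1 - y ^+ n.
Proof.
move=> y0 y1; elim: n => [|n IH]; first by rewrite !mul0r expr0 subrr.
have yn : 0 <= y ^+ n by rewrite exprn_ge0.
have yn1 : y ^+ n <= 1 by rewrite exprn_ile1// ltW.
rewrite exprS -[n.+1]addn1 natrD; move: IH yn yn1; move: (y ^+ n) => w IH w0 w1.
have : y * (n%:R * (1 - y) * w) <= y * (1 - w) by rewrite ler_wpM2l.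
have : y * w * (1 - y) <= 1 - y by apply: ler_piMl; [rewrite subr_ge0 ltW|rewrite mulr_ile1// ltW].
move: (n%:R) => N h1 h2.
suff : (N + 1) * (1 - y) * (y * w) <= y * (1 - w) + (1 - y) * (y * w) by lra.
by rewrite mulrDl mul1r mulrDl lerD2r; apply: le_trans h2; rewrite le_eqVlt;
  apply/orP; left; apply/eqP; ring.
Qed.

Lemma cvg_natr_expr z : 0 <= z -> z < 1 -> n%:R * z ^+ n @[n --> \oo] --> (0 : R).
Proof.
(* With [y] the square root, [n * z ^+ n] is [n * y ^+ n], bounded by [(1 - y)^-1], times [y ^+ n],
   which tends to 0. *)
move=> z0 z1; set y := Num.sqrt z.
have y0 : 0 <= y by exact: sqrtr_ge0.
have yz : y ^+ 2 = z by rewrite sqr_sqrtr.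
have y1 : y < 1 by rewrite -sqrtr1 ltr_sqrt.
apply: (@squeeze_cvgr _ _ _ _ (cst 0) (fun n => (1 - y)^-1 * y ^+ n)).
- near=> n; rewrite mulr_ge0 ?exprn_ge0//=.
  rewrite ler_pdivlMl ?subr_gt0// -yz -exprM mul2n -addnn exprD.
  have -> : (1 - y) * (n%:R * (y ^+ n * y ^+ n)) = n%:R * (1 - y) * y ^+ n * y ^+ n by ring.
  apply: ler_piMl; first exact: exprn_ge0.
  by apply: le_trans (natr_expr_le n y0 y1) _; rewrite lerBlDr lerDl exprn_ge0.
- exact: cvg_cst.
- rewrite -[X in _ --> X](mulr0 (1 - y)^-1); apply: cvgMr; apply: cvg_expr.
  by rewrite ger0_norm.
Unshelve. all: by end_near. Qed.

(* The Stone-Weierstrass polynomials; the extra factor n in the exponent makes them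
   converge at [s = 2^-1] too. *)
Lemma cvg_steep s : 0 <= s -> s <= 1 ->
  (1 - s ^+ n) ^+ (n * 2 ^ n)%N @[n --> \oo] --> ((s < 2^-1)%R%:R : R).
Proof.
move=> s0 s1.
have sn0 n : 0 <= s ^+ n by rewrite exprn_ge0.
have sn1 n : s ^+ n <= 1 by rewrite exprn_ile1.
have [sh|sh] := ltP s 2^-1.
  apply: (@squeeze_cvgr _ _ _ _ (fun n => 1 - n%:R * (2 * s) ^+ n) (cst 1)).
  - near=> n; apply/andP; split; last first.
      by rewrite exprn_ile1 ?subr_ge0// lerBlDr lerDl.
    have : -1 <= - s ^+ n by rewrite lerN2.
    move/(bernoulli_ge (n * 2 ^ n)); apply: le_trans.
    by rewrite natrM natrX exprMn mulrN mulrA.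
  - rewrite -[X in _ --> X]subr0; apply: cvgB; first exact: cvg_cst.
    by apply: cvg_natr_expr; lra.
  - exact: cvg_cst.
apply: (@squeeze_cvgr _ _ _ _ (cst 0) (@harmonic R)).
- near=> n; rewrite exprn_ge0 ?subr_ge0//= /harmonic/=.
  rewrite -[leRHS]mul1r ler_pdivlMr ?ltr0n//.
  set M := (n * 2 ^ n)%N; set y := s ^+ n.
  have nM : n.+1%:R <= 1 + M%:R * y.
    rewrite -natr1 addrC lerD2l natrM natrX -mulrA -exprMn ler_peMr//.
    by rewrite exprn_ege1//; lra.
  have b : 1 + M%:R * y <= (1 + y) ^+ M.
    by apply: bernoulli_ge; rewrite (le_trans _ (sn0 n))// oppr_le0.
  (* Since [n + 1 <= (1 + y) ^+ M], multiplying by it leaves at most [(1 - y ^+ 2) ^+ M <= 1]; this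
     is the harmonic bound. *)
  apply: (@le_trans _ _ ((1 - y) ^+ M * (1 + y) ^+ M)).
    by rewrite ler_wpM2l ?exprn_ge0 ?subr_ge0 ?sn1// (le_trans nM b).
  rewrite -exprMn -subr_sqr expr1n exprn_ile1 ?subr_ge0 ?exprn_ile1 ?sn0 ?sn1//.
  by rewrite lerBlDr lerDl sqr_ge0.
- exact: cvg_cst.
- exact: cvg_harmonic.
Unshelve. all: by end_near. Qed.

(** The first sine is positive inside the unit interval and the second changes sign exactly at [b].
    The half-frequencies are harmless: the product expands in [cos (2 pi t)] and [sin (2 pi t)]. *)
Lemma sin_prod_lt0 (b t : R) : 0 <= b < 1 -> 0 <= t < 1 ->
  (sin (pi * t) * sin (pi * (b - t)) < 0) = (b < t).
Proof.
move=> /andP[b0 b1] /andP[t0 t1]; have p0 := pi_gt0 R.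
have [->|tn0] := eqVneq t 0.
  by rewrite mulr0 sin0 mul0r ltxx; apply/esym/negbTE; rewrite -leNgt.
have st : 0 < sin (pi * t).
  apply: sin_gt0_pi; apply/andP; split; last by rewrite gtr_pMr.
  by apply: mulr_gt0 => //; rewrite lt0r tn0.
rewrite pmulr_rlt0//; have [bt|tb] := ltP b t.
  rewrite -opprB mulrN sinN oppr_lt0; apply: sin_gt0_pi.
  apply/andP; split; first by apply: mulr_gt0 => //; rewrite subr_gt0.
  by rewrite gtr_pMr//; lra.
apply/negbTE; rewrite -leNgt; apply: sin_ge0_pi.
apply/andP; split; first by apply: mulr_ge0; rewrite ?subr_ge0// ltW.
by rewrite ger_pMr//; lra.
Qed.

End Steep.

(** * The trigonometric system on the unit cell *)

Section Fourier.
Context {R : realType}.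
Notation plane := (measurableTypeR R * measurableTypeR R)%type.
Notation leb2 := (@lebesgue2 R).
Notation cell := (@square R 1).
Implicit Types (k l e : int * int) (i j : (int * int) * bool) (x : R * R).

(** The flag [true] marks multiplication by the imaginary unit. Over real scalars each exponential
    gives two orthonormal vectors, and the two coefficients are the real and imaginary parts of the
    Fourier coefficient. *)
Definition basis i : plane -> R[i] := fun x =>
  if i.2 then Complex (- sin (theta i.1 x)) (cos (theta i.1 x))
  else Complex (cos (theta i.1 x)) (sin (theta i.1 x)).

Lemma measurable_theta k : measurable_fun setT (theta k : plane -> R).
Proof.
by apply: measurable_funD; apply: measurable_funM; first [exact: measurable_cst|
  exact: measurable_fst|exact: measurable_snd].
Qed.

Lemma measurable_cos_theta k : measurable_fun setT (fun x : plane => cos (theta k x)).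
Proof.
apply: measurableT_comp (measurable_theta k).
by apply: continuous_measurable_fun; exact: continuous_cos.
Qed.

Lemma measurable_sin_theta k : measurable_fun setT (fun x : plane => sin (theta k x)).
Proof.
apply: measurableT_comp (measurable_theta k).
by apply: continuous_measurable_fun; exact: continuous_sin.
Qed.

Let mcell : measurable (cell : set plane).
Proof. exact: measurable_square. Qed.

Lemma integrable_cell_trig k :
  leb2.-integrable cell (EFin \o (fun x => cos (theta k x))) /\
  leb2.-integrable cell (EFin \o (fun x => sin (theta k x))).
Proof.
have c1 : continuous (fun _ : R => 1 : R) by move=> t; exact: cvg_cst.
split; [have [+ _] := weight_cos 1 k c1|have [+ _] := weight_sin 1 k c1];
  congr integrable; apply/funext => x /=; by rewrite !mul1r.
Qed.

Lemma integrable_cell_cst (c : R) : leb2.-integrable cell (EFin \o (fun _ : plane => c)).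
Proof.
have [/(integrableZl mcell c) + _] := integrable_cell_trig (0, 0).
congr integrable; apply/funext => x /=.
by rewrite /theta /freq mulr0 !mul0r addr0 cos0 -EFinM mulr1.
Qed.

Lemma sqint_basis i : sqint leb2 cell (basis i).
Proof.
case: i => k [] ; split; rewrite /basis/=.
- by apply: measurable_funN; exact: measurable_sin_theta.
- exact: measurable_cos_theta.
- have := integrable_cell_cst 1; congr integrable; apply/funext => x /=.
  by rewrite /cdot/= mulrNN -!expr2 addrC cos2Dsin2.
- exact: measurable_cos_theta.
- exact: measurable_sin_theta.
- have := integrable_cell_cst 1; congr integrable; apply/funext => x /=.
  by rewrite /cdot/= -!expr2 cos2Dsin2.
Qed.

Lemma inner_basis i j : inner leb2 cell (basis i) (basis j) = (i == j)%:R.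
Proof.
case: i j => [k a] [l b].
have e x : theta k x - theta l x = theta (k.1 - l.1, k.2 - l.2) x by exact: thetaB.
have [hc hs] := @Rintegral_cell_trig R (k.1 - l.1, k.2 - l.2).
have kl : ((k.1 - l.1, k.2 - l.2) == (0, 0)) = (k == l).
  by case: k l {e hc hs} => [k1 k2] [l1 l2]; rewrite !xpair_eqE/= !subr_eq0.
have [ic iS] := integrable_cell_trig (k.1 - l.1, k.2 - l.2).
have aux : \int[leb2]_(x in cell)
    (cos (theta k x) * cos (theta l x) + sin (theta k x) * sin (theta l x)) = (k == l)%:R.
  by rewrite -kl -hc; apply: eq_Rintegral => x _; rewrite -e cosB.
rewrite xpair_eqE /inner /basis; case: a; case: b => /=; rewrite ?andbT ?andbF.
- rewrite -aux; apply: eq_Rintegral => x _; rewrite /cdot/=; ring.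
- transitivity (\int[leb2]_(x in cell) (-1 * sin (theta (k.1 - l.1, k.2 - l.2) x))).
    by apply: eq_Rintegral => x _; rewrite /cdot/= -e sinB; ring.
  by rewrite RintegralZl// hs mulr0.
- apply: (etrans _ hs); apply: eq_Rintegral => x _; rewrite /cdot/= -e sinB; ring.
- by rewrite -aux.
Qed.

Notation in_spanB := (in_span leb2 cell basis).
Notation multiplierB := (multiplier leb2 cell basis).

Definition addk k l : int * int := (k.1 + l.1, k.2 + l.2).
Definition subk k l : int * int := (k.1 - l.1, k.2 - l.2).

Lemma theta_addk k l x : theta (addk k l) x = theta k x + theta l x.
Proof. by rewrite /theta /freq/= !rmorphD/=; ring. Qed.

Lemma theta_subk k l x : theta (subk k l) x = theta k x - theta l x.
Proof. by rewrite thetaB. Qed.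

Lemma multiplier_cos_theta k : multiplierB (fun x => cos (theta k x)).
Proof.
apply: multiplier_of_basis => //.
- exact: measurable_cos_theta.
- by move=> x; exact: cos_max.
move=> [l b].
rewrite (_ : mulfun _ _ = lincomb 2^-1 (basis (addk l k, b)) 2^-1 (basis (subk l k, b))).
  by apply: in_span_lincomb => //; apply: in_span_basis; exact: sqint_basis.
apply/funext => x; rewrite /mulfun /lincomb /basis/= theta_addk theta_subk.
move: (theta l x) (theta k x) => v w.
by case: b; congr Complex => /=; rewrite ?(cosD v w) ?(cosB v w) ?(sinD v w) ?(sinB v w); field.
Qed.

Lemma multiplier_sin_theta k : multiplierB (fun x => sin (theta k x)).
Proof.
apply: multiplier_of_basis => //.
- exact: measurable_sin_theta.
- by move=> x; exact: sin_max.
(* A sine is a difference of exponentials over 2i; dividing by i flips the flag, with a sign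
   depending on its old value. *)
move=> [l b]; pose c : R := if b then 2^-1 else - 2^-1.
rewrite (_ : mulfun _ _ = lincomb c (basis (addk l k, ~~ b)) (- c) (basis (subk l k, ~~ b))).
  by apply: in_span_lincomb => //; apply: in_span_basis; exact: sqint_basis.
apply/funext => x; rewrite /mulfun /lincomb /basis/= /c theta_addk theta_subk.
move: (theta l x) (theta k x) => v w.
by case: b {c}; congr Complex => /=; rewrite ?(cosD v w) ?(cosB v w) ?(sinD v w) ?(sinB v w); field.
Qed.

Definition axis (b : bool) : int * int := if b then (1, 0) else (0, 1).
Definition coord (b : bool) x : R := if b then x.1 else x.2.

Lemma theta_axis b x : theta (axis b) x = 2 * pi * coord b x.
Proof. by rewrite /theta /freq; case: b; rewrite /= !mulr1 mulr0 mul0r ?addr0 ?add0r. Qed.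

Lemma measurable_coord b : measurable_fun setT (coord b : plane -> R).
Proof. by case: b; [exact: measurable_fst|exact: measurable_snd]. Qed.

Lemma cell_coord b x : cell x -> 0 <= coord b x < 1.
Proof. by case: x => x1 x2 [/=]; rewrite !in_itv/=; case: b. Qed.

Lemma measurable_half_plane b (a : R) :
  measurable [set x : plane | a < coord b x].
Proof.
rewrite -[X in measurable X]setTI (_ : [set x | _] = coord b @^-1` `]a, +oo[); last first.
  by apply/seteqP; split => x /=; rewrite in_itv/= andbT.
exact: measurable_coord.
Qed.

Lemma multiplier_half_plane b (a : R) :
  multiplierB (\1_[set x : plane | a < coord b x] : plane -> R).
Proof.
have mA := measurable_half_plane b a.
(* Serves [a] outside [[0, 1[], where the half plane contains the cell or misses it; a multiplier
   matters only through its values on the cell. *)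
have triv c : (forall x, cell x -> \1_[set x : plane | a < coord b x] x = c :> R) ->
    0 <= c <= 1 ->
    multiplierB (\1_[set x : plane | a < coord b x] : plane -> R).
  move=> hc /andP[c0 c1]; apply: (@multiplier_cvg _ _ _ _ _ mcell _ _ (fun=> cst c) _ 1).
  - by move=> n; apply: multiplier_cst => //; exact: sqint_basis.
  - exact: measurable_indic.
  - by move=> x; rewrite indicE; case: (_ \in _); rewrite ?normr0 ?normr1.
  - by move=> _ x _; rewrite ger0_norm.
  - by move=> x Dx; rewrite hc//; exact: cvg_cst.
have [a0|a0] := ltP a 0.
  apply: (triv 1); rewrite ?lexx ?ler01// => x /(cell_coord b)/andP[x0 _].
  by rewrite indicE mem_set//=; exact: lt_le_trans a0 x0.
have [a1|a1] := leP 1 a.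
  apply: (triv 0); rewrite ?lexx ?ler01// => x /(cell_coord b)/andP[_ x1].
  rewrite indicE memNset// => /= ax; have := lt_trans ax x1.
  by rewrite ltNge a1.
(* The product-to-sum form of [2^-1 + sin (pi x) * sin (pi (a - x)) / 2], with x the chosen
   coordinate: it takes values in [[0, 1]] and, on the cell, lies below [2^-1] exactly on the half
   plane. *)
pose s x : R := cst 2^-1 x + (cst (cos (pi * a) / 4) x * cos (theta (axis b) x) +
   cst (sin (pi * a) / 4) x * sin (theta (axis b) x) + cst (- (cos (pi * a) / 4)) x).
have sE x : s x = 2^-1 + sin (pi * coord b x) * sin (pi * (a - coord b x)) / 2.
  rewrite /s !theta_axis /cst.
  have -> : 2 * pi * coord b x = (pi * coord b x) *+ 2 by rewrite -[RHS]mulr_natl mulrA.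
  rewrite cos_mulr2n sin_mulr2n (mulrBr pi a) sinB.
  have -> : cos (pi * coord b x) ^+ 2 = 1 - sin (pi * coord b x) ^+ 2 by rewrite cos2sin2.
  by field.
have s01 x : 0 <= s x <= 1.
  have := sin_max (pi * coord b x); have := sin_max (pi * (a - coord b x)).
  rewrite sE; move: (sin _) (sin _) => p q; rewrite !ler_norml => /andP[h1 h2] /andP[h3 h4].
  by apply/andP; split; nra.
have ms : multiplierB s.
  have hc := fun c : R => @multiplier_cst _ _ _ _ _ mcell _ basis c.
  apply: multiplierD => //.
  apply: multiplierD => //.
  apply: multiplierD => //.
    by apply: multiplierM => //; exact: multiplier_cos_theta.
  by apply: multiplierM => //; exact: multiplier_sin_theta.
apply: (@multiplier_cvg _ _ _ _ _ mcell _ _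
    (fun n (x : plane) => (1 - s x ^+ n) ^+ (n * 2 ^ n)%N) _ 1).
- move=> n; apply: multiplierX => //.
  apply: multiplierC => //.
  exact: multiplierX.
- exact: measurable_indic.
- by move=> x; rewrite indicE; case: (_ \in _); rewrite ?normr0 ?normr1.
- move=> n x _; have /andP[h0 h1] := s01 x.
  have sn0 : 0 <= s x ^+ n by rewrite exprn_ge0.
  have sn1 : s x ^+ n <= 1 by rewrite exprn_ile1.
  by rewrite ger0_norm ?exprn_ge0 ?exprn_ile1 ?subr_ge0// lerBlDr lerDl.
- move=> x /(cell_coord b) xc; have /andP[h0 h1] := s01 x.
  rewrite (_ : \1_[set y : plane | a < coord b y] x = (s x < 2^-1)%R%:R); first exact: cvg_steep.
  rewrite indicE; congr (nat_of_bool _)%:R.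
  have h2 : (s x < 2^-1) = (a < coord b x).
    by rewrite sE gtrDl pmulr_llt0// sin_prod_lt0 ?a0 ?a1.
  by rewrite h2; apply/idP/idP => [/set_mem//|h]; exact/mem_set.
Qed.

Lemma multiplier_indic (A : set plane) : measurable A -> multiplierB (\1_A : plane -> R).
Proof.
pose M : set (set plane) := mult_set leb2 cell basis.
have sM : sigma_algebra setT M by exact: mult_set_sigma_algebra.
(* Open half lines generate the Borel sets of the line, and taking preimages commutes with
   complements and countable unions; the product sigma-algebra is generated by these preimages. *)
have half b (B : set R) : measurable (B : set (measurableTypeR R)) -> M (coord b @^-1` B).
  have sN : sigma_algebra setT [set B : set (measurableTypeR R) | M (coord b @^-1` B)].
    case: sM => M0 MC MU; split => /=.
    - by rewrite preimage_set0.
    - by move=> B' /= /MC; rewrite !setTD preimage_setC.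
    - by move=> B' hB; rewrite preimage_bigcup; exact: MU.
  suff h : (@ocitv R).-sigma.-measurable `<=`
      [set B : set (measurableTypeR R) | M (coord b @^-1` B)] by exact: h.
  rewrite RGenOInfty.measurableE; apply: smallest_sub => //.
  move=> B' [a ->] /=.
  have -> : coord b @^-1` `]a, +oo[ = [set x : plane | a < coord b x].
    by apply/seteqP; split => x /=; rewrite in_itv/= andbT.
  by split; [exact: measurable_half_plane|exact: multiplier_half_plane].
suff h : measurable `<=` M by move=> /h[].
apply: smallest_sub => //; move=> B [] [A0 mA0 <-]; rewrite setTI.
- exact: (half true).
- exact: (half false).
Qed.

Lemma approximable_fourier f : sqint leb2 cell f -> approximable leb2 cell basis f.
Proof.
apply: approximable_sqint => //; first exact: multiplier_indic.
move=> z; apply: in_span_approximable => //.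
rewrite (_ : cst z = lincomb (complex.Re z) (basis (0, 0, false))
    (complex.Im z) (basis (0, 0, true))).
  by apply: in_span_lincomb => //; apply: in_span_basis; exact: sqint_basis.
apply/funext => x; rewrite /lincomb /basis/= /theta /freq !mulr0 !mul0r addr0 cos0 sin0.
by rewrite oppr0 !mulr0 !mulr1 addr0 add0r; case: z.
Qed.

End Fourier.

(** * The weak Laplacian *)

Section TestFunctions.
Context {R : realType}.
Notation plane := (measurableTypeR R * measurableTypeR R)%type.
Notation leb2 := (@lebesgue2 R).
Notation cell := (@square R 1).
Implicit Types (k : int * int) (al be : R) (x v : R * R).

(** The real test functions to which the weak derivatives are applied: they are the components of
    the basis functions and eigenfunctions of the second derivatives. *)
Definition plane_wave al be k x : R := wave al be 1 (theta k x).

Lemma is_derive_lineP (f : R * R -> R) x v (df : R) :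
  is_derive (0 : R) 1 (fun h : R => f (h *: v + x)) df -> is_derive x v f df.
Proof.
have e : (fun h : R => h^-1 *: ((f \o shift x) (h *: v) - f x)) =
   (fun h : R => h^-1 *: (((fun t : R => f (t *: v + x)) \o shift 0) (h *: 1) - f (0 *: v + x))).
  by apply/funext => h /=; rewrite addr0 scale0r add0r [_%:A]mulr1.
move=> [d1 d2]; split; first by rewrite /derivable e.
by move: d2; rewrite /derive -e.
Qed.

Lemma is_derive_plane_wave al be k x v : is_derive x v (plane_wave al be k)
  ((freq k.1 * v.1 + freq k.2 * v.2) * plane_wave be (- al) k x).
Proof.
apply: is_derive_lineP; set s := freq k.1 * v.1 + freq k.2 * v.2.
have -> : (fun h : R => plane_wave al be k (h *: v + x)) =
    fun h : R => al * cos (s * h + theta k x) + be * sin (s * h + theta k x).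
  apply/funext => h; rewrite /plane_wave /wave !mul1r.
  suff -> : theta k (h *: v + x) = s * h + theta k x by [].
  by rewrite /theta /s/= /GRing.scale/=; ring.
apply: trigger_derive; rewrite /GRing.scale/= /plane_wave /wave !mul1r mulr0 add0r; ring.
Qed.

Lemma derive_plane_wave al be k v : (fun x => 'D_v (plane_wave al be k) x) =
  let c := freq k.1 * v.1 + freq k.2 * v.2 in plane_wave (c * be) (- (c * al)) k.
Proof.
apply/funext => x; have [_ ->] := is_derive_plane_wave al be k x v.
by rewrite /plane_wave /wave; ring.
Qed.

Lemma continuous_plane_wave al be k : continuous (plane_wave al be k).
Proof.
move=> x; apply: (@continuous_comp _ _ _ (theta k) (wave al be 1)); last exact: continuous_wave.
apply: cvgD; (apply: cvgMr; first [exact: cvg_fst|exact: cvg_snd]).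
Qed.

(** The induction runs over all coefficients because a directional derivative of a plane wave is a
    plane wave with the same [k] and other coefficients. *)
Lemma Ck_plane_wave n al be k : Ck n (plane_wave al be k).
Proof.
elim: n al be => [|n IH] al be; split => //; try exact: continuous_plane_wave.
move=> v _; split; last by rewrite derive_plane_wave; exact: IH.
by move=> x; have [] := is_derive_plane_wave al be k x v.
Qed.

Lemma periodic_plane_wave al be k : torus_periodic (plane_wave al be k).
Proof.
move=> x m l; have -> : plane_wave al be k (x.1 + m%:~R, x.2 + l%:~R) =
    wave al be 1 (theta k x + 2 * pi * (k.1 * m + k.2 * l)%:~R).
  by rewrite /plane_wave /theta /freq/= rmorphD !rmorphM/=; congr wave; ring.
have [c s] := @cos_sin_2pi_int R (k.1 * m + k.2 * l).
by rewrite /plane_wave /wave !mul1r cosD sinD c s; ring.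
Qed.

Lemma test_function_plane_wave al be k : test_function (plane_wave al be k).
Proof. by split=> [|n]; [exact: periodic_plane_wave|exact: Ck_plane_wave]. Qed.

Lemma partial20_plane_wave al be k x :
  partial (2, 0)%N (plane_wave al be k) x = - freq k.1 ^+ 2 * plane_wave al be k x.
Proof.
rewrite /partial/= derive_plane_wave (derive_val (is_derive := is_derive_plane_wave _ _ k x e1)).
by rewrite /e1 /plane_wave /wave/=; ring.
Qed.

Lemma partial02_plane_wave al be k x :
  partial (0, 2)%N (plane_wave al be k) x = - freq k.2 ^+ 2 * plane_wave al be k x.
Proof.
rewrite /partial/= derive_plane_wave (derive_val (is_derive := is_derive_plane_wave _ _ k x e2)).
by rewrite /e2 /plane_wave /wave/=; ring.
Qed.


End TestFunctions.

Section WeakLaplacian.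
Context {R : realType}.
Notation plane := (measurableTypeR R * measurableTypeR R)%type.
Notation leb2 := (@lebesgue2 R).
Notation cell := (@square R 1).
Local Notation Re := complex.Re.
Local Notation Im := complex.Im.
Implicit Types (k : int * int) (i : (int * int) * bool) (u g : R * R -> R[i]).

Let mcell : measurable (cell : set plane).
Proof. exact: measurable_square. Qed.

(** Weak derivatives are stated separately for real and imaginary parts, so inner products must be
    separated likewise; erasing one component preserves square integrability. *)
Lemma sqint_split (f g : plane -> R[i]) : sqint leb2 cell f -> sqint leb2 cell g ->
  inner leb2 cell f g = \int[leb2]_(x in cell) (Re (f x) * Re (g x)) +
    \int[leb2]_(x in cell) (Im (f x) * Im (g x)).
Proof.
move=> sf sg; have [f1 f2 fi] := sf; have [g1 g2 gi] := sg.
have s1 : sqint leb2 cell (fun x => Complex (Re (f x)) 0).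
  split => //=.
  apply: le_integrable fi => //.
    apply/measurable_EFinP; apply: measurable_funTS.
    by apply: measurable_cdot => //=; exact: measurable_cst.
  move=> x _; rewrite lee_fin !ger0_norm ?cdot_ge0// /cdot/= mulr0 addr0 lerDl.
  by rewrite -expr2 sqr_ge0.
have s2 : sqint leb2 cell (fun x => Complex 0 (Im (f x))).
  split => //=.
  apply: le_integrable fi => //.
    apply/measurable_EFinP; apply: measurable_funTS.
    by apply: measurable_cdot => //=; exact: measurable_cst.
  move=> x _; rewrite lee_fin !ger0_norm ?cdot_ge0// /cdot/= mulr0 add0r lerDr.
  by rewrite -expr2 sqr_ge0.
have i1 := sqint_cdot mcell s1 sg; have i2 := sqint_cdot mcell s2 sg.
rewrite /inner /cdot RintegralD//.
- by move: i1; congr integrable; apply/funext => x; rewrite /= /cdot/= mul0r addr0.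
- by move: i2; congr integrable; apply/funext => x; rewrite /= /cdot/= mul0r add0r.
Qed.

Lemma basis_plane_wave i x : basis i x =
  if i.2 then Complex (plane_wave 0 (-1) i.1 x) (plane_wave 1 0 i.1 x)
  else Complex (plane_wave 1 0 i.1 x) (plane_wave 0 1 i.1 x) :> R[i].
Proof.
by rewrite /basis /plane_wave /wave; case: i.2; rewrite !mul1r !mul0r ?mulN1r ?addr0 ?add0r.
Qed.

Lemma weak_partialR_plane_wave (v w : R * R -> R) (a : nat * nat) (c : R) al be k :
  ~~ odd (a.1 + a.2) -> (forall x, partial a (plane_wave al be k) x = c * plane_wave al be k x) ->
  weak_partialR a v w -> leb2.-integrable cell (EFin \o (fun x => v x * plane_wave al be k x)) ->
  \int[leb2]_(x in cell) (w x * plane_wave al be k x) =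
  c * \int[leb2]_(x in cell) (v x * plane_wave al be k x).
Proof.
move=> ea pc /(_ _ (test_function_plane_wave al be k)).
rewrite -signr_odd (negPf ea) expr0 mul1r => <- iv.
by rewrite -RintegralZl//; apply: eq_Rintegral => x _; rewrite pc; ring.
Qed.

(** Each component of a basis function is a plane wave, an eigenfunction of the derivative, and at
    even order integration by parts carries no sign. *)
Lemma weak_partial_basis u g (a : nat * nat) (c : R) i :
  ~~ odd (a.1 + a.2) ->
  (forall al be x, partial a (plane_wave al be i.1) x = c * plane_wave al be i.1 x) ->
  sqint leb2 cell u -> sqint leb2 cell g -> weak_partial a u g ->
  inner leb2 cell g (basis i) = c * inner leb2 cell u (basis i).
Proof.
move=> ea pc su sg [w1 w2].
have sb := @sqint_basis R i; have [b1 b2 _] := sb; have [u1 u2 ui] := su.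
have iu (v : plane -> R) al be : measurable_fun setT v ->
    (forall x, v x ^+ 2 <= cdot (u x) (u x)) -> al ^+ 2 + be ^+ 2 = 1 ->
    leb2.-integrable cell (EFin \o (fun x => v x * plane_wave al be i.1 x)).
  move=> mv vu ab.
  have i1 := integrable_lin 1 1 mcell ui (integrable_cell_cst 1).
  apply: le_integrable i1 => //.
    apply/measurable_EFinP; apply: measurable_funTS; apply: measurable_funM => //.
    apply: measurableT_comp (measurable_theta i.1).
    by apply: continuous_measurable_fun; exact: continuous_wave.
  move=> x _; have d0 := cdot_ge0 (u x).
  rewrite lee_fin !mul1r [leRHS]ger0_norm; last by rewrite addr_ge0.
  have h := wave_sqr al be 1 (theta i.1 x); rewrite ab in h.
  have t1 : `|wave al be 1 (theta i.1 x)| <= 1.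
    by rewrite -(@expr_le1 _ 2)// real_normK ?num_real// -[leRHS]h lerDl sqr_ge0.
  rewrite /plane_wave normrM; apply: le_trans (ler_piMr (normr_ge0 _) t1) _.
  have p2 : `|v x| ^+ 2 <= cdot (u x) (u x) by rewrite real_normK ?num_real.
  apply: le_trans (_ : `|v x| ^+ 2 + 1 <= _); last by rewrite lerD2r.
  by move: `|v x| => p; have := sqr_ge0 (p - 1); have := sqr_ge0 p; rewrite sqrrB1; lra.
have h1 x : Re (u x) ^+ 2 <= cdot (u x) (u x) by rewrite /cdot -!expr2 lerDl sqr_ge0.
have h2 x : Im (u x) ^+ 2 <= cdot (u x) (u x) by rewrite /cdot -!expr2 lerDr sqr_ge0.
rewrite !sqint_split// mulrDr; congr (_ + _).
  under eq_Rintegral do rewrite basis_plane_wave.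
  under [in RHS]eq_Rintegral do rewrite basis_plane_wave.
  by case: i.2 => /=; apply: weak_partialR_plane_wave w1 _ => //; apply: iu => //; ring.
under eq_Rintegral do rewrite basis_plane_wave.
under [in RHS]eq_Rintegral do rewrite basis_plane_wave.
by case: i.2 => /=; apply: weak_partialR_plane_wave w2 _ => //; apply: iu => //; ring.
Qed.

Lemma laplacian_basis u g1 g2 i : sqint leb2 cell u ->
  sqint leb2 cell g1 -> sqint leb2 cell g2 ->
  weak_partial (2, 0)%N u g1 -> weak_partial (0, 2)%N u g2 ->
  inner leb2 cell (lincomb 1 g1 1 g2) (basis i) =
  - (freq i.1.1 ^+ 2 + freq i.1.2 ^+ 2) * inner leb2 cell u (basis i).
Proof.
move=> su s1 s2 w1 w2; have sb := @sqint_basis R i.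
have h1 (al be : R) x := partial20_plane_wave al be i.1 x.
have h2 (al be : R) x := partial02_plane_wave al be i.1 x.
rewrite inner_lincombl// (weak_partial_basis _ h1 su s1 w1)//.
by rewrite (weak_partial_basis _ h2 su s2 w2)//; ring.
Qed.

End WeakLaplacian.

(** * The observability estimate *)

Section Estimate.
Context {R : realType}.
Notation plane := (measurableTypeR R * measurableTypeR R)%type.
Notation leb2 := (@lebesgue2 R).
Notation cell := (@square R 1).
Local Notation Re := complex.Re.
Local Notation Im := complex.Im.
Implicit Types (k : int * int) (i : (int * int) * bool) (u : R * R -> R[i]).

Let mcell : measurable (cell : set plane).
Proof. exact: measurable_square. Qed.

Definition shell (N : nat) : seq ((int * int) * bool) :=
  allpairs pair (circle N) [:: false; true].

Lemma shell_uniq N : uniq (shell N).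
Proof.
by apply: allpairs_uniq => //; [exact: circle_uniq|move=> [a b] [c d]].
Qed.

Lemma mem_shell N i : (i \in shell N) = (i.1.1 ^+ 2 + i.1.2 ^+ 2 == N%:Z).
Proof.
rewrite -mem_circle; case: i => k b; apply/allpairsP/idP => /= [[[l c] [lN _ [-> _]]]//|kN].
by exists (k, b); split => //; case: b.
Qed.

Lemma proj_shell N u x : proj leb2 cell basis (shell N) u x =
  let p k := inner leb2 cell u (basis (k, false)) in
  let q k := inner leb2 cell u (basis (k, true)) in
  Complex (trigR (circle N) p q x) (trigI (circle N) p q x).
Proof.
rewrite projE /= /trigR /trigI !big_allpairs; congr Complex.
  by apply: eq_bigr => k _; rewrite !big_cons big_nil /basis/=; ring.
by apply: eq_bigr => k _; rewrite !big_cons big_nil /basis/=; ring.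
Qed.

Lemma square_sub_cell (eta : R) : eta <= 1 -> square eta `<=` cell.
Proof.
move=> e1 [x y] [/=]; rewrite !in_itv/= => /andP[x0 xe] /andP[y0 ye].
by rewrite /square/= !in_itv/= x0 y0 !(lt_le_trans _ e1).
Qed.

(** The residual off the circle is controlled by [F] through the gap, and the projection by
    [trig_observability]. The 120 is 60 times the 2 from splitting the squared norm of [u - r] on
    the small square. *)
Lemma quasimode_estimate (eta X : R) (N D : nat) u L : 0 < eta -> eta <= 1 ->
  (0 < D)%N -> 16 * kappa <= D%:R * eta ^+ 4 -> (8 * D ^ 6 < N)%N ->
  sqint leb2 cell u -> sqint leb2 cell L ->
  (forall i, inner leb2 cell L (basis i) =
     - (freq i.1.1 ^+ 2 + freq i.1.2 ^+ 2) * inner leb2 cell u (basis i)) ->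
  (forall n : int, n != N%:Z -> 1 <= `|(2 * pi) ^+ 2 * n%:~R - X|) ->
  inner leb2 cell u u <=
    120 * kappa / eta ^+ 4 * (inner leb2 (square eta) u u +
      inner leb2 cell (lincomb (-1) L (- X) u) (lincomb (-1) L (- X) u)) +
    inner leb2 cell (lincomb (-1) L (- X) u) (lincomb (-1) L (- X) u).
Proof.
move=> eta0 eta1 D0 De DN su sL Leig gap; set F := lincomb (-1) L (- X) u.
have sF : sqint leb2 cell F by exact: sqint_lincomb.
pose r := resid leb2 cell basis (shell N) u.
pose P := proj leb2 cell basis (shell N) u.
have ob := @inner_basis R; have sb := @sqint_basis R.
have sr : sqint leb2 cell r by exact: sqint_resid.
have sP : sqint leb2 cell P by exact: sqint_proj.
have Feig i : inner leb2 cell F (basis i) =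
    ((2 * pi) ^+ 2 * (i.1.1 ^+ 2 + i.1.2 ^+ 2)%:~R - X) * inner leb2 cell u (basis i).
  by rewrite inner_lincombl// Leig /freq rmorphD !rmorphXn/=; ring.
have rF : inner leb2 cell r r <= inner leb2 cell F F.
  apply: (@resid_le _ _ _ _ _ mcell _ _ sb ob _ _
    (fun i => i.1.1 ^+ 2 + i.1.2 ^+ 2 == N%:Z)) => //.
  - exact: approximable_fourier.
  - exact: shell_uniq.
  - by move=> i; rewrite mem_shell.
  - move=> i /gap g; rewrite Feig exprMn ler_peMl ?sqr_ge0//.
    by rewrite -[leRHS]real_normK ?num_real// exprn_ege1.
pose p k := inner leb2 cell u (basis (k, false)).
pose q k := inner leb2 cell u (basis (k, true)).
set S := \sum_(k <- circle N) (p k ^+ 2 + q k ^+ 2).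
have SE : \sum_(i <- shell N) inner leb2 cell u (basis i) ^+ 2 = S.
  rewrite big_allpairs; apply: eq_bigr => k _.
  by rewrite !big_cons big_nil /= addr0.
have uE : inner leb2 cell u u = S + inner leb2 cell r r.
  by rewrite inner_resid// ?shell_uniq// SE subrKC.
have sub := square_sub_cell eta1.
have msq : measurable (square eta : set plane) by exact: measurable_square.
have obs := trig_observability p q eta0 eta1 D0 De DN.
have restr f : sqint leb2 cell f -> sqint leb2 (square eta) f.
  move=> [f1 f2 fi]; split => //; exact: integrableS fi.
have PE : \int[leb2]_(x in square eta)
    (trigR (circle N) p q x ^+ 2 + trigI (circle N) p q x ^+ 2) = inner leb2 (square eta) P P.
  by apply: eq_Rintegral => x _; rewrite /P /cdot proj_shell/= -!expr2.
rewrite PE -/S in obs.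
(* Only [u] is observed on the small square, so [P] is traded for [u] at the cost of [r], whose norm
   there is at most its norm on the cell. *)
have Plc : P = lincomb 1 u (-1) r.
  apply/funext => x; rewrite /r /resid /lincomb/= -/P.
  by case: (P x) => a b; congr Complex => /=; ring.
have Ple : inner leb2 (square eta) P P <=
    2 * inner leb2 (square eta) u u + 2 * inner leb2 (square eta) r r.
  rewrite Plc; apply: le_trans (inner_lincomb_le msq _ _ (restr _ su) (restr _ sr)) _.
  by rewrite sqrrN expr1n !mulr1.
have rle : inner leb2 (square eta) r r <= inner leb2 cell r r.
  rewrite /inner /Rintegral fine_le//.
  - by apply: integrable_fin_num => //; have [] := restr _ sr.
  - by apply: integrable_fin_num => //; have [] := sr.
  - apply: ge0_subset_integral => //; last by move=> x _; rewrite lee_fin cdot_ge0.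
    have [q1 q2 _] := sr; apply/measurable_EFinP; apply: measurable_funTS.
    exact: measurable_cdot.
rewrite uE; have e4 : 0 < eta ^+ 4 by rewrite exprn_gt0.
have k32 := @kappa_ge32 R; have k0 : 0 < kappa :> R by rewrite (lt_le_trans _ k32).
apply: lerD => //.
have -> : 120 * kappa / eta ^+ 4 * (inner leb2 (square eta) u u + inner leb2 cell F F) =
    (2 * inner leb2 (square eta) u u + 2 * inner leb2 cell F F) / (eta ^+ 4 / (60 * kappa)).
  by field; rewrite !gt_eqF.
have c60 : 0 < eta ^+ 4 / (60 * kappa).
  by apply: divr_gt0 => //; apply: mulr_gt0.
rewrite ler_pdivlMr// mulrC; apply: le_trans obs _.
apply: le_trans Ple _; rewrite lerD2l ler_pM2l//; exact: le_trans rle rF.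
Qed.

Lemma L2normE (A : set (R * R)) u : L2norm A u =
  ((\int[leb2]_(x in cell `&` A) (cdot (u x) (u x))%:E) `^ 2^-1)%E.
Proof.
rewrite /L2norm unlock; congr (_ `^ _)%E; rewrite [RHS]integral_mkcond.
apply: eq_integral => x _; rewrite !patchE; case: ifPn => _; last first.
  by rewrite abse0 poweR0r.
rewrite /cdot; case: (u x) => a b /=.
congr EFin; rewrite ger0_norm ?sqrtr_ge0// powR_mulrn ?sqrtr_ge0//.
by rewrite sqr_sqrtr ?addr_ge0 ?sqr_ge0// !expr2.
Qed.

Lemma L2norm_fin (A : set (R * R)) u :
  leb2.-integrable (cell `&` A) (EFin \o (fun x => cdot (u x) (u x))) ->
  measurable (cell `&` A : set plane) ->
  L2norm A u = (Num.sqrt (inner leb2 (cell `&` A) u u))%:E.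
Proof.
move=> iu mA; rewrite L2normE -powR12_sqrt ?inner_ge0//.
by rewrite -poweR_EFin /inner /Rintegral fineK//; exact: integrable_fin_num.
Qed.

Lemma L2_sqint u : L2 u -> sqint leb2 cell u.
Proof.
move=> [_ m1 m2]; rewrite L2normE setIT => h; split => //.
apply/integrableP; split.
  by apply/measurable_EFinP; apply: measurable_funTS; exact: measurable_cdot.
under eq_integral do rewrite gee0_abs ?lee_fin ?cdot_ge0//.
rewrite ltNge leye_eq; apply/negP => /eqP e; move: h.
by rewrite e poweRyr ?invr_eq0// ltxx.
Qed.

Lemma measurable_torus_ball (e : R) : measurable (torus_ball e : set plane).
Proof.
have -> : torus_ball e = \bigcup_(k : int) \bigcup_(l : int)
    [set x : plane | Num.sqrt ((x.1 - k%:~R) ^+ 2 + (x.2 - l%:~R) ^+ 2) < e].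
  apply/seteqP; split => x; first by move=> [k [l h]]; exists k => //; exists l.
  by move=> [k _ [l _ h]]; exists k, l.
apply: countable_bigcupT_measurable => // k; apply: countable_bigcupT_measurable => // l.
rewrite -[X in measurable X]setTI (_ : [set x | _] =
    (fun x : plane => Num.sqrt ((x.1 - k%:~R) ^+ 2 + (x.2 - l%:~R) ^+ 2))
      @^-1` `]-oo, e[); last first.
  by apply/seteqP; split => x /=; rewrite in_itv.
have : measurable_fun setT (fun x : plane => Num.sqrt ((x.1 - k%:~R) ^+ 2 + (x.2 - l%:~R) ^+ 2)).
  apply: measurableT_comp.
    by apply: continuous_measurable_fun; exact: sqrt_continuous.
  apply: measurable_funD; apply: measurable_funX; apply: measurable_funB;
    first [exact: measurable_fst|exact: measurable_snd|exact: measurable_cst].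
by apply.
Qed.

Lemma square_sub_torus_ball (eta e : R) : 0 < eta -> 2 * eta <= e ->
  square eta `<=` torus_ball e.
Proof.
move=> eta0 ee [x y] [/=]; rewrite !in_itv/= => /andP[x0 xe] /andP[y0 ye].
exists 0, 0; rewrite /= !subr0.
have e0 : 0 <= e by lra.
have egt0 : 0 < e by lra.
rewrite -[ltRHS](ger0_norm e0) -sqrtr_sqr ltr_sqrt ?exprn_gt0//.
have h1 : x ^+ 2 <= eta ^+ 2 by rewrite ler_sqr ?nnegrE; lra.
have h2 : y ^+ 2 <= eta ^+ 2 by rewrite ler_sqr ?nnegrE; lra.
have h3 : (2 * eta) ^+ 2 <= e ^+ 2 by rewrite ler_sqr ?nnegrE; lra.
have h4 : 0 < eta ^+ 2 by rewrite exprn_gt0.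
rewrite exprMn in h3; lra.
Qed.

End Estimate.

(** * Choice of the constants *)

Section Constants.
Context {R : realType}.
Implicit Types (eps h : R).

Lemma pi_le4 : pi <= 4 :> R.
Proof. by have := @pihalf_lt2 R; rewrite ltr_pdivrMr//; lra. Qed.

(* Chosen so that [8 * D ^ 6 < N] with [D] of order [272 * kappa * eps ^- 4] and [N]
   at least [eps ^- 32 / 64 - 1]. *)
Definition rate : R := 64 * (8 * (272 * kappa) ^+ 6 + 2).

Lemma rate_ge1 : 1 <= rate.
Proof.
have k32 := @kappa_ge32 R; rewrite /rate.
have K0 : 0 <= 272 * kappa :> R by lra.
have : 0 <= (272 * kappa) ^+ 6 :> R by exact: exprn_ge0.
move: (_ ^+ 6) => z; lra.
Qed.

Lemma frequency_shell eps h : 0 < eps -> eps < rate^-1 -> 0 < h -> h < eps ^+ 16 ->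
  exists N D : nat, [/\ (0 < D)%N, 16 * kappa <= D%:R * (eps / 2) ^+ 4,
    (8 * D ^ 6 < N)%N &
    forall n : int, n != N%:Z -> 1 <= `|(2 * pi) ^+ 2 * n%:~R - h ^- 2|].
Proof.
move=> eps0 epsr h0 he; have r1 := rate_ge1.
have k32 := @kappa_ge32 R; have k0 : 0 < kappa :> R by lra.
have eps1 : eps < 1 by rewrite (lt_le_trans epsr)// invf_le1// (lt_le_trans _ r1).
have pi2 := @pi_ge2 R; have pi4 := pi_le4.
pose X := h ^- 2 / (2 * pi) ^+ 2.
have pp : 0 < (2 * pi) ^+ 2 :> R by rewrite exprn_gt0// mulr_gt0//; lra.
have X0 : 0 <= X by rewrite divr_ge0// ?(ltW pp)// invr_ge0 sqr_ge0.
(* Truncating [X + 2^-1] rounds to a nearest integer. The successor in [D] puts it strictly above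
   the value required by diagonal dominance with [eta = eps / 2]. *)
pose N := Num.truncn (X + 2^-1); pose D := (Num.truncn (16 * kappa / (eps / 2) ^+ 4)).+1.
have [N1 N2] : N%:R <= X + 2^-1 /\ X + 2^-1 < N%:R + 1.
  have := @Num.Theory.truncn_itv R (X + 2^-1); rewrite addr_ge0// => /(_ isT)/andP[h1 h2].
  by split; rewrite // natr1.
exists N, D; split => //.
- rewrite -ler_pdivrMr ?exprn_gt0 ?divr_gt0//; apply: ltW; exact: truncnS_gt.
- rewrite -(ltr_nat R) natrM natrX.
  pose z : R := eps ^- 4; pose K : R := 272 * kappa.
  have z1 : rate < z.
    rewrite /z -[rate]invrK ltf_pV2 ?posrE ?exprn_gt0 ?invr_gt0//; last by lra.
    apply: le_lt_trans epsr; rewrite -[leRHS]expr1; apply: ler_wiXn2l => //; exact: ltW.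
  have z0 : 0 < z by lra.
  (* Here 272 is [256 + 16]: the 256 is [16 * 2 ^ 4], and the remaining [16 * kappa * z] absorbs the
     successor. *)
  have DK : D%:R <= K * z.
    have h1 : D%:R <= 16 * kappa / (eps / 2) ^+ 4 + 1.
      rewrite /D -natr1 lerD2r.
      suff y0 : 0 <= 16 * kappa / (eps / 2) ^+ 4 :> R by case/andP: (truncn_itv y0).
      apply: divr_ge0; first by lra.
      by rewrite exprn_ge0// divr_ge0// ltW.
    apply: le_trans h1 _.
    have -> : 16 * kappa / (eps / 2) ^+ 4 = 256 * (kappa * z) by rewrite /z; field; rewrite gt_eqF.
    have : 1 <= kappa * z by apply: mulr_ege1; lra.
    rewrite /K -mulrA; lra.
  have K0 : 0 <= K by rewrite /K; lra.
  have D6 : D%:R ^+ 6 <= K ^+ 6 * z ^+ 6 by rewrite -exprMn lerXn2r ?nnegrE// mulr_ge0// ltW.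
  (* [z ^+ 8] is [eps ^- 32], hence at most [h ^- 2]; 64 bounds [(2 * pi) ^+ 2] by way of
     [pi <= 4]. *)
  have Xz : z ^+ 8 / 64 <= X.
    rewrite /X; apply: ler_pM; rewrite ?exprn_ge0 ?(ltW z0) ?invr_ge0//.
      rewrite /z -exprVn -exprM -exprVn.
      have -> : eps^-1 ^+ (4 * 8) = (eps ^+ 16)^-1 ^+ 2 by rewrite -exprVn -exprM.
      rewrite lerXn2r ?nnegrE ?invr_ge0 ?exprn_ge0 ?(ltW h0) ?(ltW eps0)//.
      by rewrite lef_pV2 ?posrE ?exprn_gt0// ltW.
    rewrite lef_pV2 ?posrE// (_ : 64 = 8 ^+ 2); last by ring.
    by rewrite lerXn2r ?nnegrE//; lra.
  have z2 : rate <= z ^+ 2.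
    by apply: (le_trans (ltW z1)); rewrite -[leLHS]expr1; apply: ler_weXn2l => //; lra.
  have z6 : 1 <= z ^+ 6 by rewrite exprn_ege1//; lra.
  (* [D ^ 6] consumes six of the eight powers of [z], and the other two beat the constant [rate],
     whose summand 2 covers the rounding of [N]. *)
  have : z ^+ 6 * rate <= z ^+ 8.
    have -> : z ^+ 8 = z ^+ 6 * z ^+ 2 by ring.
    by rewrite ler_wpM2l// (le_trans _ z6).
  rewrite /rate -/K => h8.
  have KK : 0 <= K ^+ 6 by rewrite exprn_ge0.
  move: D6 Xz z6 h8 KK N1 N2; move: (z ^+ 8) (z ^+ 6) (K ^+ 6) (D%:R ^+ 6) N%:R => z8 z6 K6 D6 n.
  clear; move=> h1 h2 h3 h4 h5 h6 h7.
  have h8 : z6 * (64 * (8 * K6 + 2)) = 512 * (K6 * z6) + 128 * z6 by ring.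
  lra.
- move=> n nN.
  (* By rounding, every integer other than [N] is at least one half away from [X]; the factor
     [(2 * pi) ^+ 2 >= 2] raises this to 1. *)
  have nX : 2^-1 <= `|n%:~R - X|.
    rewrite ler_normr; move: nN; rewrite neq_lt -!lezD1 -!(ler_int R) !rmorphD/=.
    by move=> /orP[nN|nN]; apply/orP; [right|left]; lra.
  have -> : (2 * pi) ^+ 2 * n%:~R - h ^- 2 = (2 * pi) ^+ 2 * (n%:~R - X).
    by rewrite /X mulrBr; congr (_ - _); rewrite mulrCA divff ?mulr1// gt_eqF.
  rewrite normrM (gtr0_norm pp).
  have : 2 <= (2 * pi) ^+ 2 :> R.
    have : 2 ^+ 2 <= (2 * pi) ^+ 2 :> R by rewrite lerXn2r ?nnegrE//; lra.
    by apply: le_trans; rewrite expr2; lra.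
  move: nX; move: (`|_|) (_ ^+ 2) => a b; clear => a2 b2.
  have : 2 * 2^-1 <= b * a by apply: ler_pM => //; lra.
  by rewrite divff.
Qed.

(** Passes from squared norms to norms with [w = eps ^- 2]. As [K + 1] and [w] are at least 1, the
    square of the right-hand side dominates [(K + 1) * w ^+ 2 * (A + B)], already term by term. *)
Lemma sqrt_combine (K w A' A U B : R) : 0 <= K -> 1 <= w ->
  0 <= A' -> 0 <= A -> 0 <= B -> A' <= A -> U <= K * w ^+ 2 * (A' + B) + B ->
  Num.sqrt U <= (K + 1) * w ^+ 2 * Num.sqrt A + (K + 1) * w * Num.sqrt B.
Proof.
move=> K0 w1 A'0 A0 B0 AA UB; have w0 : 0 <= w by rewrite (le_trans _ w1).
have wsq : 1 <= w ^+ 2 by rewrite exprn_ege1.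
have {UB}UC : U <= (K + 1) * w ^+ 2 * (A + B).
  have -> : (K + 1) * w ^+ 2 * (A + B) = K * w ^+ 2 * (A + B) + w ^+ 2 * (A + B).
    by ring.
  apply: (le_trans UB); apply: lerD.
    by rewrite ler_wpM2l ?mulr_ge0 ?sqr_ge0// lerD2r.
  by rewrite -[leLHS]mul1r; apply: ler_pM => //; rewrite lerDr.
set C := K + 1 in UC *; have C1 : 1 <= C by rewrite lerDr.
have C0 : 0 <= C by rewrite (le_trans _ C1).
have a0 := sqrtr_ge0 A; have b0 := sqrtr_ge0 B.
have y0 : 0 <= C * w ^+ 2 * Num.sqrt A + C * w * Num.sqrt B.
  by rewrite addr_ge0// !mulr_ge0// sqr_ge0.
rewrite -(ger0_norm y0) -sqrtr_sqr; apply: ler_wsqrtr; apply: (le_trans UC).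
rewrite -{1}(sqr_sqrtr A0) -{1}(sqr_sqrtr B0).
move: a0 b0; move: (Num.sqrt A) (Num.sqrt B) => a b a0 b0.
rewrite -subr_ge0.
have -> : (C * w ^+ 2 * a + C * w * b) ^+ 2 - C * w ^+ 2 * (a ^+ 2 + b ^+ 2) =
    C * w ^+ 2 * ((C * w ^+ 2 - 1) * a ^+ 2 + (C - 1) * b ^+ 2 + 2 * (C * w * (a * b))).
  by ring.
have Cw1 : 1 <= C * w ^+ 2 by rewrite mulr_ege1.
have Cw0 : 0 <= C * w ^+ 2 by rewrite (le_trans _ Cw1).
apply: mulr_ge0 => //; apply: addr_ge0; first apply: addr_ge0.
- by rewrite mulr_ge0 ?sqr_ge0// subr_ge0.
- by rewrite mulr_ge0 ?sqr_ge0// subr_ge0.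
- by rewrite !mulr_ge0.
Qed.

End Constants.

Theorem theorem1 (R : realType) (delta : R) (hdelta : 0 < delta) :
  exists C eps0 : R, [/\ 0 < C, 0 < eps0 &
    forall eps : R, 0 < eps -> eps < eps0 ->
    forall h : R, 0 < h -> h < eps `^ (16 + delta) ->
    forall u : R * R -> R[i], sobolevH 2 u ->
    forall Lu : R * R -> R[i], is_laplacian u Lu ->
      (L2norm setT u <=
         (C * eps ^- 4)%:E * L2norm (torus_ball eps) u +
         (C * eps ^- 2 * h ^- 2)%:E *
           L2norm setT (fun x => (- (h ^+ 2)%:C * Lu x - u x)%R))%E].
Proof.
have r1 := @rate_ge1 R; have k32 := @kappa_ge32 R.
(* 1920 is [120 * 2 ^ 4], the powers of 2 coming from [eta = eps / 2]; the 1 is the one added to [K]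
   in [sqrt_combine]. *)
exists (1920 * kappa + 1), rate^-1; split.
- by lra.
- by rewrite invr_gt0; lra.
move=> eps e0 er h h0 he u [Lu2 _] L [g1 [g2 [G1 G2 w1 w2 Leq]]].
have eps1 : eps < 1 by rewrite (lt_le_trans er)// invf_le1// (lt_le_trans _ r1).
have he16 : h < eps ^+ 16.
  apply: lt_le_trans he _; rewrite -powR_mulrn ?(ltW e0)//.
  by apply: ger_powR; [rewrite e0 ltW|rewrite lerDl ltW].
have [N [D [D0 De DN gap]]] := frequency_shell e0 er h0 he16.
have su := L2_sqint Lu2; have s1 := L2_sqint G1; have s2 := L2_sqint G2.
have LE : L = lincomb 1 g1 1 g2.
  by apply/funext => x; rewrite Leq /lincomb !mul1r; case: (g1 x) (g2 x) => [a b] [c d].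
have mcell := @measurable_square R 1.
have sL : sqint lebesgue2 (square 1) L by rewrite LE; exact: sqint_lincomb.
(* With side [eps / 2] the square has diagonal less than [eps], so it lies in the ball about its
   corner at the origin. *)
have eta0 : 0 < eps / 2 by rewrite divr_gt0.
have eta1 : eps / 2 <= 1 by lra.
have Leig i := laplacian_basis i su s1 s2 w1 w2.
rewrite -LE in Leig.
have main := quasimode_estimate eta0 eta1 D0 De DN su sL Leig gap.
pose F := lincomb (-1) L (- h ^- 2) u.
have {}main : inner lebesgue2 (square 1) u u <= 120 * kappa / (eps / 2) ^+ 4 *
    (inner lebesgue2 (square (eps / 2)) u u + inner lebesgue2 (square 1) F F) +
    inner lebesgue2 (square 1) F F := main.
have sF : sqint lebesgue2 (square 1) F by exact: sqint_lincomb.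
set f := (fun x => _).
have hn0 : h != 0 by rewrite gt_eqF.
(* Scaling is written as a degenerate linear combination so that the bilinearity lemmas apply; the
   factor [h ^+ 2] later cancels the [h ^- 2] of the statement. *)
have fE : f = lincomb (h ^+ 2) F 0 F.
  apply/funext => x; rewrite /f /F /lincomb/=; case: (L x) (u x) => [a b] [c d].
  by apply/eqP; rewrite eq_complex /=; apply/andP; split; apply/eqP; field.
have sf : sqint lebesgue2 (square 1) f by rewrite fE; exact: sqint_lincomb.
have ff : inner lebesgue2 (square 1) f f = (h ^+ 2) ^+ 2 * inner lebesgue2 (square 1) F F.
  by rewrite fE inner_lincombl// ?inner_lincombr//; [ring|exact: sqint_lincomb].
have mB : measurable (square 1 `&` torus_ball eps : set (measurableTypeR R * measurableTypeR R)).
  by apply: measurableI => //; exact: measurable_torus_ball.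
have iB : (@lebesgue2 R).-integrable (square 1 `&` torus_ball eps)
    (EFin \o (fun x => cdot (u x) (u x))).
  by have [_ _ ui] := su; apply: integrableS ui.
rewrite (L2norm_fin iB mB) !L2norm_fin ?setIT//; last 2 first.
- by case: sf.
- by case: su.
rewrite -!EFinM -EFinD lee_fin ff sqrtrM ?sqr_ge0// sqrtr_sqr ger0_norm ?sqr_ge0//.
have AA : inner lebesgue2 (square (eps / 2)) u u <=
    inner lebesgue2 (square 1 `&` torus_ball eps) u u.
  have ss : square (eps / 2) `<=` square 1 `&` torus_ball eps.
    move=> x xs; split; first exact: square_sub_cell xs.
    by apply: square_sub_torus_ball xs => //; lra.
  have ms := measurable_square (eps / 2).
  rewrite /inner /Rintegral fine_le//.
  - by apply: integrable_fin_num => //; apply: integrableS iB.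
  - exact: integrable_fin_num.
  - apply: ge0_subset_integral => //; last by move=> x _; rewrite lee_fin cdot_ge0.
    exact: measurable_int iB.
have A0 := inner_ge0 lebesgue2 (square 1 `&` torus_ball eps) u.
have B0 := inner_ge0 lebesgue2 (square 1) F.
have A0' := inner_ge0 lebesgue2 (square (eps / 2)) u.
have U0 := inner_ge0 lebesgue2 (square 1) u.
set w := eps ^- 2; have w0 : 0 < w by rewrite invr_gt0 exprn_gt0.
have w1le : 1 <= w by rewrite invf_ge1 ?exprn_gt0// exprn_ile1// ltW.
have w4 : eps ^- 4 = w ^+ 2 by rewrite /w exprVn -exprM.
have kw : 120 * kappa / (eps / 2) ^+ 4 = 1920 * kappa * w ^+ 2.
  by rewrite /w; field; rewrite gt_eqF.
rewrite kw in main; rewrite w4.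
have -> (C y : R) : C * w * h ^- 2 * (h ^+ 2 * y) = C * w * y by field.
apply: sqrt_combine w1le A0' A0 B0 AA main.
by lra.
Qed.
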